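(* Let $H\in(0,3/4)$, let $T\in(0,\infty)$ be fixed, and let $G^H=\{G^H_t,\ t\ge 0\}$ be a centered Gaussian process, self-similar of index $H$, satisfying assumptions (A1), (A2) and (A3) stated in the context. Let $u=\{u_t,\ t\in[0,T]\}$ be a Hölder continuous stochastic process of order $\beta$ with $\beta>1-H$, and set $$Z_t=\int_0^t u_s\,dG^H_s,\qquad t\in[0,T].$$ Then, as $n\to\infty$, $$n^{2H-1}V_n(Z)_t\longrightarrow \int_0^t |u_s|^2\,ds$$ almost surely and uniformly in $t\in[0,T]$.
   Context: All processes are defined on a probability space $(\Omega,\mathcal F,P)$; $[x]$ denotes the integer part of $x$. For a process $Z$ and an integer $n\ge1$, the realized quadratic variation is $$V_n(Z)_t=\sum_{i=1}^{[nt]}\left|Z_{i/n}-Z_{(i-1)/n}\right|^2 .$$ The integral $\int_0^t u_s\,dG^H_s$ is a pathwise Riemann–Stieltjes (Young) integral. Assumptions on $G^H$: (A1) The function $d(s,t)=\mathbb E(G^H_t-G^H_s)^2$ is in $C^{1,1}$ outside the diagonal, and its mixed derivative satisfies $|\partial_{s,t}d(s,t)|=O(|t-s|^{2H-2})$. (A2) $G^H$ is Hölder continuous of order $\delta$ for any $0<\delta<H$. (A3) For integers $n,m,i\ge1$ let $I_n(i)=\{j:\ \frac jm\in(\frac{i-1}n,\frac in]\}$ (this set depends on $m$). As $m\to\infty$ (with $n,i$ fixed), $m^{-1+2H}\sum_{j\in I_n(i)}\mathbb E|G^H_{j/m}-G^H_{(j-1)/m}|^2\to\frac1n$. *)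

(* Defs.v *)
From HB Require Import structures.
From mathcomp Require Import all_boot all_order all_algebra.
From mathcomp Require Import all_classical all_reals all_analysis.
Import Order.TTheory GRing.Theory Num.Theory.
Import numFieldNormedType.Exports.

Set Implicit Arguments.
Unset Strict Implicit.
Unset Printing Implicit Defensive.

Local Open Scope classical_set_scope.
Local Open Scope ring_scope.

Section processes.
Context {R : realType} {d : measure_display} {Omega : measurableType d}.
Variable P : probability Omega R.
Implicit Types (X G : R -> Omega -> R) (D : set R).

(* A process indexed by D is a total family X : R -> Omega -> R; its values at
   times outside D are irrelevant. *)
Definition is_process D X : Prop :=
  forall t, D t -> measurable_fun [set: Omega] (X t).

(* normal_prob m 0 is not the point mass at m in the library, hence the case
   distinction. *)
Definition gaussian_law (m s : R) (A : set R) : \bar R :=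
  if s == 0 then dirac m A else normal_prob m s A.

Definition gaussian_variable (X : Omega -> R) : Prop :=
  exists m s : R, 0 <= s /\
    forall A : set R, measurable A -> pushforward P X A = gaussian_law m s A.

Definition gaussian_process D X : Prop :=
  is_process D X /\
  forall (k : nat) (t a : 'I_k -> R), (forall i, D (t i)) ->
    gaussian_variable (fun w => \sum_(i < k) a i * X (t i) w).

Definition centered D X : Prop := forall t, D t -> ('E_P[X t] = 0)%E.

(* Equality of the finite-dimensional distributions of (X_{at})_{t >= 0} and
   (a^H X_t)_{t >= 0}, for all a > 0. *)
Definition self_similar (H : R) X : Prop :=
  forall a : R, 0 < a ->
  forall (k : nat) (t : 'I_k -> R), (forall i, 0 <= t i) ->
  forall B : set (k.-tuple R), measurable B ->
    pushforward P (fun w => [tuple X (a * t i) w | i < k]) B =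
    pushforward P (fun w => [tuple a `^ H * X (t i) w | i < k]) B.

Definition holder_on D (b : R) (f : R -> R) : Prop :=
  exists C : R, forall s t, D s -> D t -> `|f t - f s| <= C * `|t - s| `^ b.

Definition as_holder_on D (b : R) X : Prop :=
  {ae P, forall w, holder_on D b (X ^~ w)}.

(* On an unbounded time set such as [0, +oo[, Holder continuity of paths is
   understood on compact subintervals. *)
Definition as_locally_holder (b : R) X : Prop :=
  {ae P, forall w, forall K : R, 0 < K -> holder_on `[0, K] b (X ^~ w)}.

Definition sq_dist X (s t : R) : R :=
  fine ('E_P[fun w => ((X t w - X s w) ^+ 2)%R])%E.

End processes.

Section c11.
Context {R : realType}.
Implicit Type f : R -> R -> R.

Definition partial1 f : R -> R -> R := fun s t => derive1 (f ^~ t) s.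
Definition partial2 f : R -> R -> R := fun s t => derive1 (f s) t.
Definition mixed_partial f : R -> R -> R := partial2 (partial1 f).

Definition off_diagonal : set (R * R) :=
  [set p | [/\ 0 < p.1, 0 < p.2 & p.1 != p.2]].

Definition continuous2_on (U : set (R * R)) f : Prop :=
  forall p, U p -> {for p, continuous (fun q : R * R => f q.1 q.2)}.

(* C^{1,1} in the sense "once continuously differentiable in each variable":
   the partial derivatives of orders (i, j), i, j <= 1, exist and are jointly
   continuous on the open set U. *)
Definition C11_on (U : set (R * R)) f : Prop :=
  (forall s t, U (s, t) ->
    [/\ derivable (f ^~ t) s 1, derivable (f s) t 1 &
        derivable (partial1 f s) t 1]) /\
  [/\ continuous2_on U f, continuous2_on U (partial1 f),
      continuous2_on U (partial2 f) & continuous2_on U (mixed_partial f)].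

End c11.

Section riemann_stieltjes.
Context {R : realType}.
Implicit Types (f g : R -> R) (a b : R) (s : seq R) (xi : nat -> R).

(* The subdivision is a = x_0 < ... < x_k = b with s = [:: x_1; ...; x_k]
   (library convention of itv_partition); xi i is the tag in [x_i, x_(i+1)]. *)
Definition RS_tagged a b s xi : Prop :=
  itv_partition a b s /\
  forall i, (i < size s)%N -> nth b (a :: s) i <= xi i <= nth b s i.

Definition RS_mesh_lt a b s (eta : R) : Prop :=
  forall i, (i < size s)%N -> nth b s i - nth b (a :: s) i < eta.

Definition RS_sum f g a b s xi : R :=
  \sum_(i < size s) f (xi i) * (g (nth b s i) - g (nth b (a :: s) i)).

Definition is_RS_integral f g a b (I : R) : Prop :=
  forall e : R, 0 < e -> exists eta : R, 0 < eta /\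
    forall s xi, RS_tagged a b s xi -> RS_mesh_lt a b s eta ->
      `|RS_sum f g a b s xi - I| < e.

(* Value of the integral of f dg over [a, b] (0 when the Riemann-Stieltjes
   sums do not converge). *)
Definition RS_integral f g a b : R := xget 0 [set I | is_RS_integral f g a b I].

End riemann_stieltjes.

Section main_notions.
Context {R : realType} {d : measure_display} {Omega : measurableType d}.
Variable P : probability Omega R.
Implicit Types (u G : R -> Omega -> R) (H : R).

Definition integral_process u G : R -> Omega -> R :=
  fun t w => RS_integral (u ^~ w) (G ^~ w) 0 t.

Definition quad_var (n : nat) (z : R -> R) (t : R) : R :=
  \sum_(1 <= i < (Num.truncn (n%:R * t)).+1)
    `|z (i%:R / n%:R) - z (i.-1%:R / n%:R)| ^+ 2.

Definition assumption_A1 H G : Prop :=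
  C11_on off_diagonal (sq_dist P G) /\
  exists C : R, forall s t, off_diagonal (s, t) ->
    `|mixed_partial (sq_dist P G) s t| <= C * `|t - s| `^ (2 * H - 2).

Definition assumption_A2 H G : Prop :=
  forall delta, 0 < delta < H -> as_locally_holder P delta G.

Definition block (m n i : nat) : set nat :=
  [set j | i.-1%:R / n%:R < j%:R / m%:R :> R /\
           j%:R / m%:R <= i%:R / n%:R :> R].

(* The blocks are finite for m > 0, so the finitely supported sum below is an
   ordinary finite sum. *)
Definition assumption_A3 H G : Prop :=
  forall n i : nat, (0 < n)%N -> (0 < i)%N ->
    (fun m : nat => m%:R `^ (-1 + 2 * H) *
       \sum_(j \in block m n i) sq_dist P G (j.-1%:R / m%:R) (j%:R / m%:R))
      @ \oo --> (n%:R^-1 : R).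

End main_notions.

(* Main.v *)
Require Import Defs.
From mathcomp Require Import all_boot all_order all_algebra.
From mathcomp Require Import all_classical all_reals all_analysis.
From mathcomp Require Import measurable_realfun.
From mathcomp Require Import ring lra zify.
Import Order.TTheory GRing.Theory Num.Theory.
Import numFieldNormedType.Exports.

(** Almost everything happens on one path [w].  Choose [delta < H] with
    [1 < beta + delta].  Young's estimate says that over a cell of length [1/n]
      Z_(i/n) - Z_((i-1)/n) = u_((i-1)/n) (G_(i/n) - G_((i-1)/n)) + O(n^-(beta + delta)),
    and the squared errors, summed over the [O(n)] cells and multiplied by
    [n^(2H-1)], are [O(n^(2H - 2(beta + delta)))], hence negligible because
    [beta + delta > 1 > H].  What remains is the sum of [u^2] at the grid points
    against the random weights
      n^(2H-1) (G_(i/n) - G_((i-1)/n))^2.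
    If the total weight of [0, q/k] tends to [q/k] for all [q] and [k], then by
    monotonicity the weights converge to Lebesgue measure uniformly on all
    intervals [0, t] with [t <= T], and the weighted sums of the continuous
    function [u^2] converge, uniformly in [t], to its integral.  This is
    [quad_var_young_integral].

    The almost sure convergence of the weights is [ae_grid_quadratic_variation].
    The expected weights converge by [assumption_A3].  Their fluctuation is
    [Q_n = n^(2H-1) * sum_i (X_i^2 - E X_i^2)] with jointly Gaussian increments
    [X_i] of covariances [rho_ij], and the Wick formula gives
      E (sum_i (X_i^2 - E X_i^2))^4 <= 60 (sum_ij rho_ij^2)^2
    ([chaos_fourth_moment]).  Off the diagonal, [assumption_A1] and two applications
    of the mean value theorem give [|rho_ij| <= C n^(-2H) (|i - j| - 1)^(2H-2)]
    ([cov_increment_decay]); these squares are summable along a row because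
    [4 - 4H > 1], which is where [H < 3/4] enters.  Near the diagonal, where
    [assumption_A1] is silent, the Holder regularity of the paths is turned into the variance
    bound [E |G_t - G_s|^2 <= C |t - s|^(2 delta)] ([holder_variance]), which
    together with the Cauchy-Schwarz inequality suffices.  Altogether
    [E Q_n^4 = O(n^(-2 + 8(H - delta)))], which is [O(n^(-3/2))] as soon as
    [H - delta <= 1/16].  The series of the [Q_n^4] is then almost surely finite,
    so that [Q_n] tends to [0] along the full sequence.  The variance of [Q_n] is only
    bounded by a power of [n] close to [1/n], whose series diverges; this is why the
    fourth moment is needed. *)

Set Implicit Arguments.
Unset Strict Implicit.
Unset Printing Implicit Defensive.

Local Open Scope classical_set_scope.
Local Open Scope ring_scope.

(** * Young integration: the sewing estimate *)

Lemma half_split (h : nat) : [/\ h = h./2 + (odd h + h./2), (odd h <= 1)%N,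
  (h./2 <= h)%N & (h./2 * 2 <= h)%N]%N.
Proof.
have := odd_double_half h; rewrite -muln2; case: (odd h) => /=; split; lia.
Qed.

Section sewing.
Context {R : realType}.
Implicit Types (U g : nat -> R).

(** The error made over [h] steps from index [j] when the integrand [U] is frozen
    at its initial value. *)
Definition sew_defect U g (j h : nat) : R :=
  \sum_(i < h) U (j + i)%N * (g (j + i).+1 - g (j + i)%N) -
  U j * (g (j + h)%N - g j).

(** Concatenating two stretches only costs the change of [U] over the first one
    times the change of [g] over the second one. *)
Lemma sew_defectD U g j h k :
  sew_defect U g j (h + k) = sew_defect U g j h + sew_defect U g (j + h) k +
    (U (j + h)%N - U j) * (g (j + h + k)%N - g (j + h)%N).
Proof.
rewrite /sew_defect big_split_ord /=.
under [X in _ + X - _]eq_bigr do rewrite addnA.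
rewrite addnA; ring.
Qed.

Lemma sew_defect0 U g j : sew_defect U g j 0 = 0.
Proof. by rewrite /sew_defect big_ord0 addn0 subrr mulr0 subrr. Qed.

Lemma sew_defect1 U g j : sew_defect U g j 1 = 0.
Proof.
by rewrite /sew_defect big_ord1 addn0 addn1 subrr.
Qed.

(** Young's estimate on a uniform grid, by bisection: splitting [h] steps into two
    halves of [h./2] steps (and one more step, of zero defect, when [h] is odd)
    produces cross terms of size at most [c e h^(b+d)] each, and the defects of the
    two halves add up to at most the factor [2 * 2^-(b+d) < 1] of the bound to be
    proved.  Cutting at the floor of [h / 2] is what makes the halves scale
    correctly for odd [h].  The constant depends on [b + d] only, which matters
    because the Holder constants of the rescaled data depend on the mesh. *)
Lemma sew_defect_bound (b d : R) : 0 <= b -> 0 <= d -> 1 < b + d ->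
  exists2 K : R, 0 <= K & forall U g (c e : R), 0 <= c -> 0 <= e ->
  forall N : nat,
  (forall j k, (j + k <= N)%N -> `|U (j + k)%N - U j| <= c * k%:R `^ b) ->
  (forall j k, (j + k <= N)%N -> `|g (j + k)%N - g j| <= e * k%:R `^ d) ->
  forall h j, (j + h <= N)%N ->
   `|sew_defect U g j h| <= K * (c * e) * h%:R `^ (b + d).
Proof.
move=> b0 d0 bd1.
pose q : R := 2 `^ (1 - (b + d)).
have q1 : q < 1.
  rewrite /q -[ltRHS](@powRr0 _ 2) /powR ifF; last by apply/negbTE; rewrite pnatr_eq0.
  by rewrite pnatr_eq0/= ltr_expR mul0r pmulr_llt0 ?ln_gt0 ?ltr1n// subr_lt0.
(* The fixed point of K = q K + 2: half-length defects plus two cross terms. *)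
exists (2 / (1 - q)).
  by rewrite divr_ge0// subr_ge0 ltW.
move=> U g c e c0 e0 N hU hg; set K := 2 / (1 - q).
have K0 : 0 <= K by rewrite divr_ge0// subr_ge0 ltW.
have cross j h k l : (j + h + k <= N)%N -> (h + k <= l)%N ->
   `|(U (j + h)%N - U j) * (g (j + h + k)%N - g (j + h)%N)| <=
     c * e * l%:R `^ (b + d).
  move=> jN hkl; case: l hkl => [|l] hkl.
    move: hkl; rewrite leqn0 addn_eq0 => /andP[/eqP -> _].
    by rewrite addn0 subrr mul0r normr0 !mulr_ge0// powR_ge0.
  rewrite normrM; apply: (@le_trans _ _ ((c * h%:R `^ b) * (e * k%:R `^ d))).
    by rewrite ler_pM//; [apply: hU; apply: leq_trans jN; exact: leq_addr|exact: hg].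
  rewrite mulrACA ler_wpM2l ?mulr_ge0// powRD ?pnatr_eq0 ?implybT//.
  apply: ler_pM; rewrite ?powR_ge0//; apply: ge0_ler_powR; rewrite ?nnegrE// ler_nat.
    exact: leq_trans (leq_addr k h) hkl.
  exact: leq_trans (leq_addl h k) hkl.
have Kce0 : 0 <= K * (c * e) by rewrite mulr_ge0// mulr_ge0.
elim/ltn_ind => -[|h] IH j jN.
  by rewrite sew_defect0 normr0; apply: mulr_ge0 (powR_ge0 _ _).
case: h => [|h] in IH jN *.
  by rewrite sew_defect1 normr0; apply: mulr_ge0 (powR_ge0 _ _).
have [] := half_split h.+2; set p := (h.+2)./2; set o : nat := odd _.
move=> hE' o1 ple p2.
have p1 : (p < h.+2)%N by rewrite /p ltn_half_double -addnn addSnnS leq_addl.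
have jop : (j + p + o + p <= N)%N by rewrite -!addnA -hE'.
have D0 : forall j, sew_defect U g j o = 0.
  by move=> i; move: o1; case: (o) => [|[|]]// _; rewrite (sew_defect0, sew_defect1).
rewrite hE' sew_defectD sew_defectD D0 add0r -hE'.
set X := sew_defect _ _ _ p; set Y := sew_defect _ _ _ p.
set Z := _ * _; set W := _ * _.
have hX : `|X| <= K * (c * e) * p%:R `^ (b + d).
  by apply: IH => //; apply: leq_trans jN; rewrite leq_add2l.
have hY : `|Y| <= K * (c * e) * p%:R `^ (b + d) by apply: IH.
have hZ : `|Z| <= (c * e) * h.+2%:R `^ (b + d).
  by apply: cross; rewrite // hE' leq_addl.
have hW : `|W| <= (c * e) * h.+2%:R `^ (b + d).
  by apply: cross; rewrite -?addnA -?hE'.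
have hp : p%:R `^ (b + d) <= h.+2%:R `^ (b + d) * q / 2.
  rewrite -mulrA; have -> : q / 2 = (2^-1) `^ (b + d).
    rewrite -powR_inv1// -powRrM mulN1r /q.
    rewrite -powRD ?pnatr_eq0 ?implybT//; congr powR; ring.
  rewrite -powRM//; apply: ge0_ler_powR; rewrite ?nnegrE ?mulr_ge0 ?invr_ge0//.
    by rewrite addr_ge0.
  by rewrite ler_pdivlMr// -natrM ler_nat.
set A := h.+2%:R `^ _ in hZ hW hp *.
apply: (@le_trans _ _ (2 * (K * (c * e) * (A * q / 2)) + 2 * (c * e * A))).
  have : K * (c * e) * p%:R `^ (b + d) <= K * (c * e) * (A * q / 2).
    by rewrite ler_wpM2l.
  have := ler_normD (X + (Y + Z)) W; have := ler_normD X (Y + Z).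
  have := ler_normD Y Z; lra.
rewrite le_eqVlt; apply/orP; left; apply/eqP.
have : 1 - q != 0 by rewrite subr_eq0 eq_sym lt_eqF.
rewrite /K => ?; by field.
Qed.
End sewing.

Section young.
Context {R : realType}.
Implicit Types (u g Z : R -> R) (T b d : R).

(** The constant in the definition is not required to be nonnegative. *)
Lemma holder_on_ge0 (D : set R) b u : holder_on D b u ->
  exists2 C : R, 0 <= C &
    forall s t, D s -> D t -> `|u t - u s| <= C * `|t - s| `^ b.
Proof.
move=> [C hC]; exists `|C| => // s t Ds Dt.
by rewrite (le_trans (hC s t Ds Dt))// ler_wpM2r ?powR_ge0// ler_norm.
Qed.

Lemma holder_on_cvg T b u (x : nat -> R) (F : set_system nat) {FF : ProperFilter F} t :
  0 < b -> holder_on `[0, T] b u -> (forall n, 0 <= x n <= T) -> 0 <= t <= T ->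
  x n @[n --> F] --> t -> u (x n) @[n --> F] --> u t.
Proof.
move=> b0 /holder_on_ge0[C C0 hC] hx ht /cvgrPdist_lt xt.
apply/cvgrPdist_lt => e e0.
have C1 : 0 < C + 1 by rewrite ltr_wpDl.
have r0 : 0 < (e / (C + 1)) `^ b^-1 by rewrite powR_gt0// divr_gt0.
near=> n.
have hn : `|t - x n| < (e / (C + 1)) `^ b^-1 by near: n; exact: xt.
apply: (@le_lt_trans _ _ (C * `|t - x n| `^ b)).
  by apply: hC; rewrite /= in_itv/=.
apply: (@le_lt_trans _ _ (C * (e / (C + 1)))).
  rewrite ler_wpM2l//.
  have -> : e / (C + 1) = ((e / (C + 1)) `^ b^-1) `^ b.
    by rewrite -powRrM mulVf ?gt_eqF// powRr1// ltW// divr_gt0.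
  by apply: ge0_ler_powR; rewrite ?nnegrE ?powR_ge0// ltW.
by rewrite mulrCA gtr_pMr// ltr_pdivrMr// mul1r ltrDl.
Unshelve. all: by end_near. Qed.

Lemma cvg_truncn_div t : 0 <= t ->
  (Num.truncn (n.+1%:R * t))%:R / n.+1%:R @[n --> \oo] --> (t : R).
Proof.
move=> t0; apply/cvgrPdist_lt => e e0; near=> n.
have /truncn_itv/andP[h1 h2] : 0 <= n.+1%:R * t by rewrite mulr_ge0.
have n0 : 0 < n.+1%:R :> R by [].
rewrite ger0_norm; last by rewrite subr_ge0 ler_pdivrMr// [leRHS]mulrC.
have : n.+1%:R^-1 < e.
  near: n; have := @near_infty_natSinv_lt R (PosNum e0); exact.
have : t - n.+1%:R^-1 < (Num.truncn (n.+1%:R * t))%:R / n.+1%:R.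
  by rewrite ltr_pdivlMr// mulrBl mulVf ?gt_eqF// [t * _]mulrC ltrBlDr natr1.
by move=> H he; apply: lt_trans he; rewrite ltrBlDl -ltrBlDr.
Unshelve. all: by end_near. Qed.

(** The indefinite Young integral [Z], characterised by its local expansion
    [Z t - Z s = u s * (g t - g s) + O((t - s)^(b + d))].  The left-point sums over
    the grid of mesh [1/(n+1)] satisfy this expansion between grid points with a
    constant independent of [n], and stay bounded; their limit along an
    ultrafilter exists by compactness and inherits the expansion.  Only the
    existence of some [Z] is needed, so that no Cauchy estimate is required:
    uniqueness, up to a constant, follows from the expansion. *)
Lemma young_germ T b d u g : 0 < T -> 0 < b -> 0 < d -> 1 < b + d ->
  holder_on `[0, T] b u -> holder_on `[0, T] d g ->
  exists Z, exists2 K : R, 0 <= K & forall s t, 0 <= s -> s <= t -> t <= T ->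
    `|Z t - Z s - u s * (g t - g s)| <= K * (t - s) `^ (b + d).
Proof.
move=> T0 b0 d0 bd1 hu hg.
have [Cu Cu0 HCu] := holder_on_ge0 hu; have [Cg Cg0 HCg] := holder_on_ge0 hg.
have [K K0 HK] := @sew_defect_bound R b d (ltW b0) (ltW d0) bd1.
pose x (n i : nat) : R := i%:R / n.+1%:R.
pose N (n : nat) (t : R) := Num.truncn (n.+1%:R * t).
pose U n i := u (x n i); pose V n i := g (x n i).
pose Zn n t := \sum_(i < N n t) U n i * (V n i.+1 - V n i).
have xN0 n t : 0 <= x n (N n t) by rewrite divr_ge0.
have xNle n t : 0 <= t -> x n (N n t) <= t.
  by move=> t0; rewrite ler_pdivrMr// [leRHS]mulrC truncn_le mulr_ge0.
have xNge n t : 0 <= t -> t - n.+1%:R^-1 <= x n (N n t).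
  move=> t0; have /truncn_itv/andP[_ h] : 0 <= n.+1%:R * t by rewrite mulr_ge0.
  rewrite ler_pdivlMr// mulrBl mulVf// [t * _]mulrC lerBlDr natr1; exact: ltW.
have xle n j k : (j <= k)%N -> x n j <= x n k.
  by move=> jk; rewrite ler_pM2r ?invr_gt0// ler_nat.
have Nle n s t : s <= t -> (N n s <= N n t)%N.
  by move=> st; apply: le_truncn; rewrite ler_pM2l.
pose K' := K * (Cu * Cg).
have K'0 : 0 <= K' by rewrite !mulr_ge0.
have germ n s t : 0 <= s -> s <= t -> t <= T ->
  `|Zn n t - Zn n s - U n (N n s) * (V n (N n t) - V n (N n s))|
    <= K' * (x n (N n t) - x n (N n s)) `^ (b + d).
  move=> s0 st tT; have Nst := Nle n s t st.
  have -> : Zn n t - Zn n s - U n (N n s) * (V n (N n t) - V n (N n s)) =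
            sew_defect (U n) (V n) (N n s) (N n t - N n s).
    rewrite /sew_defect /Zn; move: (N n s) (N n t) Nst => p q /subnKC <-.
    rewrite addKn big_split_ord/=; congr (_ - _).
    by rewrite addrAC subrr add0r.
  pose r : R := n.+1%:R^-1; have r0 : 0 <= r by rewrite invr_ge0.
  have hol (w : R -> R) (C q : R) j k : 0 <= C -> 0 < q ->
      (forall s t, `[0, T]%classic s -> `[0, T]%classic t ->
        `|w t - w s| <= C * `|t - s| `^ q) -> (j + k <= N n t)%N ->
      `|w (x n (j + k)%N) - w (x n j)| <= (C * r `^ q) * k%:R `^ q.
    move=> C0 q0 hw jk.
    have jkT : x n (j + k)%N <= T.
      by apply: le_trans tT; apply: le_trans (xNle n t _); [exact: xle|exact: le_trans st].
    have jT : x n j <= T by apply: le_trans jkT; apply: xle; exact: leq_addr.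
    apply: (le_trans (hw _ _ _ _)); rewrite /= ?in_itv/= ?divr_ge0//=.
    rewrite -mulrA ler_wpM2l// -powRM// /x natrD mulrDl addrAC subrr add0r.
    by rewrite ger0_norm 1?mulrC// divr_ge0.
  have := HK (U n) (V n) (Cu * r `^ b) (Cg * r `^ d)
     (mulr_ge0 Cu0 (powR_ge0 _ _)) (mulr_ge0 Cg0 (powR_ge0 _ _)) (N n t).
  move=> /(_ (fun j k => hol u Cu b j k Cu0 b0 HCu)).
  move=> /(_ (fun j k => hol g Cg d j k Cg0 d0 HCg)).
  move=> /(_ (N n t - N n s)%N (N n s)); rewrite subnKC// => /(_ (leqnn _)).
  move=> /le_trans; apply.
  rewrite [Cu * _ * _]mulrACA -powRD; last by rewrite invr_eq0 pnatr_eq0/= implybT.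
  rewrite mulrA -/K' -mulrA ler_wpM2l// -powRM//.
  by rewrite natrB// mulrBr mulrC [r * _]mulrC.
pose M := `|u 0| * (Cg * T `^ d) + K' * T `^ (b + d).
have ZnM n t : 0 <= t -> t <= T -> `|Zn n t| <= M.
  move=> t0 tT.
  have N0 : N n 0 = 0%N by rewrite /N mulr0 truncn0.
  have Zn0 : Zn n 0 = 0 by rewrite /Zn N0 big_ord0.
  have x0 : x n 0%N = 0 by rewrite /x mul0r.
  have := germ n 0 t (lexx _) t0 tT.
  rewrite Zn0 N0 subr0 /U /V x0 subr0 => H1.
  have H2 : `|u 0 * (g (x n (N n t)) - g 0)| <= `|u 0| * (Cg * T `^ d).
    rewrite normrM ler_wpM2l//; apply: (le_trans (HCg _ _ _ _)).
    - by rewrite /= in_itv/= lexx ltW.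
    - by rewrite /= in_itv/= xN0 (le_trans (xNle n t t0)).
    rewrite subr0 ger0_norm// ler_wpM2l//; apply: ge0_ler_powR; rewrite ?nnegrE//.
    - exact: ltW. - exact: ltW. exact: le_trans (xNle n t t0) tT.
  have H3 : K' * x n (N n t) `^ (b + d) <= K' * T `^ (b + d).
    rewrite ler_wpM2l//; apply: ge0_ler_powR; rewrite ?nnegrE//.
    - lra. - exact: ltW. exact: le_trans (xNle n t t0) tT.
  rewrite /M; set A := u 0 * _ in H1 H2.
  have := ler_normD (Zn n t - A) A; rewrite subrK; lra.
(* One ultrafilter for all times t: limits along it commute with sums, so the
   expansion, which involves two times, passes to the limit. *)
have [F [FU FN]] := ultraFilterLemma eventually_filter.
have cvgZ t : 0 <= t -> t <= T -> exists l : R, Zn n t @[n --> F] --> l.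
  move=> t0 tT.
  have UF : UltraFilter (Zn n t @[n --> F]).
    apply: (@Build_UltraFilter _ _ (fmap_proper_filter _ _)) => G PG sFG.
    apply/seteqP; split => // A GA.
    have [//|FA] := @in_ultra_setVsetC _ _ (Zn ^~ t @^-1` A) FU.
    have /sFG GA' : (Zn n t @[n --> F]) (~` A) by exact: FA.
    by have [y []] := filter_ex (filterI GA GA').
  have := @segment_compact R (- M) M; rewrite compact_ultra => /(_ _ UF) [].
    apply: (@filterS _ F _ setT _ _ filterT) => n _ /=.
    by rewrite in_itv/= -ler_norml; exact: ZnM.
  by move=> l [_ /= ?]; exists l.
pose Z t := xget (0 : R) [set l : R | Zn n t @[n --> F] --> l].
have ZP t : 0 <= t -> t <= T -> Zn n t @[n --> F] --> Z t.
  move=> t0 tT; have [l hl] := cvgZ t t0 tT.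
  by rewrite /Z; case: xgetP => [y _//|/(_ l)].
have xF t : 0 <= t -> x n (N n t) @[n --> F] --> t.
  move=> t0; apply: cvg_trans (cvg_truncn_div t0) => A /=; exact: FN.
exists Z; exists (K' * 2 `^ (b + d)); first by rewrite mulr_ge0// powR_ge0.
move=> s t s0 st tT; have [->|] := eqVneq s t.
  by rewrite !subrr mulr0 subr0 normr0 !mulr_ge0// powR_ge0.
move=> neq; have {neq}st' : s < t by rewrite lt_neqAle neq.
have t0 := le_trans s0 st; have sT := le_trans st tT.
have limx (w : R -> R) (q r : R) : 0 < q -> holder_on `[0, T] q w -> 0 <= r -> r <= T ->
    w (x n (N n r)) @[n --> F] --> w r.
  move=> q0 hw r0 rT; apply: (holder_on_cvg q0 hw); last exact: xF.
    by move=> n; rewrite xN0 (le_trans (xNle n r r0)).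
  by rewrite r0.
apply: (@ler_cvg_to _ F _ R
   (fun n => `|Zn n t - Zn n s - U n (N n s) * (V n (N n t) - V n (N n s))|)
   (fun=> K' * 2 `^ (b + d) * (t - s) `^ (b + d))).
- apply: cvg_norm; apply: cvgB; first by apply: cvgB; exact: ZP.
  apply: cvgM; first exact: (limx u b s).
  by apply: cvgB; [exact: (limx g d t)|exact: (limx g d s)].
- exact: cvg_cst.
- apply: FN; near=> n; apply: (le_trans (germ n s t s0 st tT)).
  rewrite -mulrA ler_wpM2l// -powRM ?subr_ge0//.
  have rts : n.+1%:R^-1 < t - s.
    near: n; have ts0 : 0 < t - s by rewrite subr_gt0.
    exact: (@near_infty_natSinv_lt R (PosNum ts0)).
  apply: ge0_ler_powR; rewrite ?nnegrE ?subr_ge0 ?mulr_ge0 ?subr_ge0//.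
  + lra.
  + by apply: xle; exact: Nle.
  + move: (xNle n t t0) (xNge n s s0) rts.
    by move: (x n _) (x n (N n s)) (n.+1%:R^-1) => A B r; lra.
Unshelve. all: by end_near. Qed.

End young.

(** * Riemann-Stieltjes sums *)

Section riemann_stieltjes_germ.
Context {R : realType}.
Implicit Types (u g Z : R -> R) (T b d : R).

(** Subdivisions of small mesh exist; without them, convergence of the
    Riemann-Stieltjes sums would be an empty condition and would not determine
    the integral. *)
Lemma RS_partition_exists (a b eta : R) : a <= b -> 0 < eta ->
  exists s, itv_partition a b s /\ RS_mesh_lt a b s eta.
Proof.
move=> ab eta0.
have eta20 : 0 < eta / 2 by rewrite divr_gt0.
have [N] : exists N : nat, b - a <= N%:R * (eta / 2).
  exists (Num.truncn ((b - a) / (eta / 2))).+1.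
  have h : 0 <= (b - a) / (eta / 2) by rewrite divr_ge0 ?subr_ge0// ltW.
  by have /andP[_ /ltW] := truncn_itv h; rewrite ler_pdivrMr.
elim: N a ab => [|N IH] a ab.
  rewrite mul0r subr_le0 => ba; have -> : a = b by apply/eqP; rewrite eq_le ab.
  by exists [::].
rewrite -natr1 mulrDl mul1r => hN.
have [->|neq] := eqVneq a b; first by exists [::].
have ltab : a < b by rewrite lt_neqAle neq.
have [ba|ab'] := leP b (a + eta / 2).
  exists [:: b]; split; first exact: itv_partition1.
  by case=> // _ /=; lra.
have [|s [[ps ls] ms]] := IH _ (ltW ab'); first lra.
exists (a + eta / 2 :: s); split; first by split; rewrite //= ps ltrDl eta20.
by case=> [|i] /= hi; [lra | exact: ms].
Qed.

Lemma is_RS_integral_unique u g a b I J : a <= b ->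
  is_RS_integral u g a b I -> is_RS_integral u g a b J -> I = J.
Proof.
move=> ab hI hJ; apply/eqP; rewrite -subr_eq0 -normr_le0.
apply/ler_addgt0Pr => e e0; rewrite add0r.
have e20 : 0 < e / 2 by rewrite divr_gt0.
have [r [r0 Hr]] := hI _ e20; have [q [q0 Hq]] := hJ _ e20.
have rq0 : 0 < Num.min r q by rewrite lt_min r0.
have [s [ps ms]] := RS_partition_exists ab rq0.
pose xi i := nth b (a :: s) i.
have ts : RS_tagged a b s xi.
  split => // i hi; rewrite /xi lexx/=.
  by case: ps => /(pathP b)/(_ i hi)/ltW.
have := Hr s xi ts; have := Hq s xi ts.
set S := RS_sum _ _ _ _ _ _ => h1 h2.
have {}h1 : `|S - J| < e / 2.
  by apply: h1 => i hi; apply: lt_le_trans (ms i hi) _; rewrite ge_min lexx orbT.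
have {}h2 : `|S - I| < e / 2.
  by apply: h2 => i hi; apply: lt_le_trans (ms i hi) _; rewrite ge_min lexx.
have := ler_distD S I J; rewrite (distrC I S); lra.
Qed.

(** For any subdivision and any tags, each term of a Riemann-Stieltjes sum differs
    from the increment of [Z] by [O(D^(b+d))], where [D] is the length of the cell:
    the local expansion of [Z] costs this much, and moving the tag to the left
    endpoint also.  As [b + d > 1], the sum of these errors is at most the total
    length times a positive power of the mesh. *)
Lemma RS_integral_germ T b d u g Z K t :
  0 < b -> 0 < d -> 1 < b + d ->
  holder_on `[0, T] b u -> holder_on `[0, T] d g ->
  (forall s t, 0 <= s -> s <= t -> t <= T ->
    `|Z t - Z s - u s * (g t - g s)| <= K * (t - s) `^ (b + d)) ->
  0 <= t -> t <= T -> RS_integral u g 0 t = Z t - Z 0.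
Proof.
move=> b0 d0 bd1 /holder_on_ge0[Cu Cu0 hu] /holder_on_ge0[Cg Cg0 hg] hZ t0 tT.
have isI : is_RS_integral u g 0 t (Z t - Z 0).
  move=> e e0; pose C := Cu * Cg + `|K|.
  have C0 : 0 <= C by rewrite addr_ge0 ?mulr_ge0.
  have D0 : 0 < (C + 1) * (t + 1) by rewrite mulr_gt0// ltr_wpDl.
  pose p := b + d - 1; have p0 : 0 < p by rewrite subr_gt0.
  pose z := e / ((C + 1) * (t + 1)); have z0 : 0 < z by rewrite divr_gt0.
  exists (z `^ p^-1); split; first exact: powR_gt0.
  move=> s xi [ps txi] ms.
  pose x i := nth t (0 :: s) i.
  have xS i : nth t s i = x i.+1 by [].
  have x_lt i : (i < size s)%N -> x i < x i.+1.
    by case: ps => /(pathP t) h _ /h.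
  have xT i : (i <= size s)%N -> 0 <= x i <= t.
    by move=> hi; rewrite itv_partition_nth_ge//= itv_partition_nth_le.
  have teles : Z t - Z 0 = \sum_(i < size s) (Z (x i.+1) - Z (x i)).
    rewrite -(big_mkord xpredT (fun i => Z (x i.+1) - Z (x i))).
    rewrite telescope_sumr// /x (itv_partition_nth_size _ ps).
    by [].
  rewrite /RS_sum teles -sumrB.
  apply: (le_lt_trans (ler_norm_sum _ _ _)).
  apply: (@le_lt_trans _ _ (\sum_(i < size s) C * z * (x i.+1 - x i))).
    apply: ler_sum => i _; rewrite xS -/(x i).
    have hi := ltn_ord i; have lti := x_lt i hi.
    have /andP[xi1 xi2] := txi i hi; rewrite xS -/(x i) in xi1 xi2.
    have /andP[x0 _] := xT i (ltnW hi); have /andP[_ xt] := xT i.+1 hi.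
    have memD y : x i <= y -> y <= x i.+1 -> y \in `[0, T].
      by move=> h1 h2; rewrite in_itv/= (le_trans x0 h1) (le_trans h2)// (le_trans xt).
    have Dx0 : 0 <= x i.+1 - x i by rewrite subr_ge0 ltW.
    have h1 : `|(u (xi i) - u (x i)) * (g (x i.+1) - g (x i))| <=
        Cu * Cg * (x i.+1 - x i) `^ (b + d).
      rewrite normrM powRD; last by apply/implyP => _; rewrite subr_eq0 gt_eqF.
      rewrite mulrACA; apply: ler_pM => //.
        apply: le_trans (hu _ _ _ _) _.
        - exact: (memD _ _ (ltW lti)).
        - exact: memD.
        rewrite ler_wpM2l// ger0_norm ?subr_ge0//.
        by apply: ge0_ler_powR; rewrite ?nnegrE ?subr_ge0 ?lerD2r// ltW.
      apply: le_trans (hg _ _ _ _) _.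
      - exact: (memD _ _ (ltW lti)).
      - exact: (memD _ (ltW lti)).
      by rewrite ger0_norm.
    have h2 : `|Z (x i.+1) - Z (x i) - u (x i) * (g (x i.+1) - g (x i))| <=
        `|K| * (x i.+1 - x i) `^ (b + d).
      apply: le_trans (hZ _ _ x0 (ltW lti) (le_trans xt tT)) _.
      by rewrite ler_wpM2r ?powR_ge0// ler_norm.
    have h3 : (x i.+1 - x i) `^ (b + d) <= z * (x i.+1 - x i).
      have -> : b + d = p + 1 by rewrite /p subrK.
      rewrite powRD; last by apply/implyP => _; rewrite subr_eq0 gt_eqF.
      rewrite powRr1// ler_wpM2r//.
      have -> : z = (z `^ p^-1) `^ p.
        by rewrite -powRrM mulVf ?gt_eqF// powRr1// ltW.
      apply: ge0_ler_powR; rewrite ?nnegrE ?powR_ge0//; first exact: ltW.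
      exact: ltW (ms i hi).
    rewrite -mulrA; apply: le_trans (ler_wpM2l C0 h3).
    rewrite /C mulrDl; set E := (_ - _) `^ _ in h1 h2 *.
    set A := (u (xi i) - u (x i)) * _ in h1.
    set B := Z _ - _ - _ in h2.
    rewrite (_ : _ * _ - _ = A - B); last by rewrite /A /B; ring.
    by have := ler_normB A B; lra.
  rewrite -mulr_sumr -(big_mkord xpredT (fun i => x i.+1 - x i)) telescope_sumr//.
  rewrite {1}/x (itv_partition_nth_size _ ps) subr0 /z.
  rewrite (_ : _ * _ * t = e * (C * t / ((C + 1) * (t + 1)))); last by ring.
  rewrite gtr_pMr// ltr_pdivrMr// mul1r.
  apply: (@le_lt_trans _ _ (C * (t + 1))); first by rewrite ler_wpM2l// lerDl.
  by rewrite ltr_pM2r ?ltrDl ?ltr_wpDl.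
rewrite /RS_integral; case: xgetP => [y _ yI|/(_ (Z t - Z 0))]; last by [].
exact: is_RS_integral_unique yI isI.
Qed.
End riemann_stieltjes_germ.

(** * Uniform convergence of weighted sums *)

Section weighted_sums.
Context {R : realType}.
Implicit Types (F : nat -> R) (f : R -> R) (T e s t : R).

(** The index range is the one of the realized quadratic variation at time [t]: the
    cells of the grid that end at or before [t]. *)
Definition grid_sum F (n : nat) (t : R) : R :=
  \sum_(1 <= i < (Num.truncn (n%:R * t)).+1) F i.

Lemma grid_sumB F n s t : s <= t ->
  grid_sum F n t - grid_sum F n s =
  \sum_((Num.truncn (n%:R * s)).+1 <= i < (Num.truncn (n%:R * t)).+1) F i.
Proof.
move=> st; rewrite /grid_sum [in LHS](@big_cat_nat _ _ _ (Num.truncn (n%:R * s)).+1)//=.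
  by rewrite addrAC subrr add0r.
by rewrite ltnS le_truncn// ler_wpM2l.
Qed.

Lemma grid_index n s t i : (0 < n)%N -> 0 <= t ->
  ((Num.truncn (n%:R * s)).+1 <= i < (Num.truncn (n%:R * t)).+1)%N ->
  s - n%:R^-1 < (i.-1%:R / n%:R : R) /\ (i%:R / n%:R : R) <= t.
Proof.
move=> n0 t0 /andP[h1 h2]; have nR : 0 < n%:R :> R by rewrite ltr0n.
split; last first.
  rewrite ler_pdivrMr// [leRHS]mulrC -truncn_ge_nat ?mulr_ge0//.
have i0 : (0 < i)%N by apply: leq_trans h1.
rewrite ltr_pdivlMr// mulrBl mulVf ?gt_eqF// ltrBlDr natr1 prednK// mulrC.
have [s0|s0] := leP 0 s; last first.
  by apply: (@lt_le_trans _ _ 0); rewrite ?pmulr_rlt0.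
by move: h1; rewrite truncn_lt_nat// mulr_ge0.
Qed.

Lemma grid_sum_le F n s t : (forall i, 0 <= F i) -> s <= t ->
  grid_sum F n s <= grid_sum F n t.
Proof.
by move=> F0 st; rewrite -subr_ge0 grid_sumB// sumr_ge0.
Qed.

(** Polya's argument: monotone functions which converge at the points [q/k] to the
    continuous function [t] converge uniformly on compact intervals. *)
Lemma grid_sum_uniform (w : nat -> nat -> R) T : 0 <= T ->
  (forall n i, 0 <= w n i) ->
  (forall k q, (0 < k)%N ->
     grid_sum (w n) n (q%:R / k%:R) @[n --> \oo] --> (q%:R / k%:R : R)) ->
  forall e, 0 < e -> \forall n \near \oo, forall t, 0 <= t <= T ->
    `|grid_sum (w n) n t - t| <= e.
Proof.
move=> T0 w0 hw e e0.
have e20 : 0 < e / 2 by rewrite divr_gt0.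
pose k := (Num.truncn (e / 2)^-1).+1.
have kR : 0 < k%:R :> R by rewrite ltr0n.
have ke : k%:R^-1 <= e / 2.
  rewrite invf_ple ?posrE//; apply: ltW.
  have h : 0 <= (e / 2)^-1 by rewrite invr_ge0 ltW.
  by have /andP[] := truncn_itv h.
pose Q := (Num.truncn (k%:R * T)).+2.
have : \forall n \near \oo, forall q : 'I_Q,
    `|grid_sum (w n) n (q%:R / k%:R) - q%:R / k%:R| <= e / 2.
  apply: filter_forall => q.
  have /cvgrPdist_le/(_ _ e20) := hw k q isT.
  by apply: filterS => n; rewrite distrC.
apply: filterS => n hn t /andP[t0 tT].
have /truncn_itv/andP[] : 0 <= k%:R * t by rewrite mulr_ge0.
set q := Num.truncn (k%:R * t) => q1 q2.
have qQ : (q.+1 < Q)%N.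
  by rewrite /Q !ltnS le_truncn// ler_wpM2l.
have := hn (Ordinal qQ); have := hn (Ordinal (ltnW qQ)) => /=.
have a1 : q%:R / k%:R <= t by rewrite ler_pdivrMr// [leRHS]mulrC.
have a2 : t <= q.+1%:R / k%:R by rewrite ler_pdivlMr// [leLHS]mulrC ltW.
have a3 : q.+1%:R / k%:R = q%:R / k%:R + k%:R^-1 :> R.
  by rewrite -natr1 mulrDl mul1r.
have := grid_sum_le n (w0 n) a1; have := grid_sum_le n (w0 n) a2.
rewrite a3 in a2 *; move: (k%:R^-1) (q%:R / k%:R) ke a1 a2 => r y ke a1 a2.
move: (grid_sum _ _ _) (grid_sum _ _ t) (grid_sum _ _ (y + r)) => A B C h1 h2.
rewrite !ler_norml => /andP[? ?] /andP[? ?]; apply/andP; split; lra.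
Qed.

Definition uniformly_continuous_on T f := forall e, 0 < e -> exists2 eta : R, 0 < eta &
  forall s t, 0 <= s <= T -> 0 <= t <= T -> `|t - s| <= eta -> `|f t - f s| <= e.

Lemma uniformly_continuous_integrable T f t : uniformly_continuous_on T f -> t <= T ->
  lebesgue_measure.-integrable `[0, t] (EFin \o f).
Proof.
move=> hf tT; apply: continuous_compact_integrable; first exact: segment_compact.
apply/subspace_continuousP => x /=; rewrite in_itv/= => /andP[x0 xt].
apply/cvgrPdist_le => e e0; have [r r0 hr] := hf _ e0.
near=> y.
have /= : y \in `[0, t] by near: y; exact: withinT.
rewrite in_itv/= => /andP[y0 yt].
apply: hr; rewrite ?y0 ?x0 ?(le_trans xt)//=; first exact: le_trans tT.
near: y; apply: cvg_within.
by exists r => //= z /=; rewrite /ball_ => /ltW.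
Unshelve. all: by end_near. Qed.

(** The counterpart, for the Lebesgue integral, of freezing the integrand at the
    left endpoint. *)
Lemma Rintegral_germ T f e s t : uniformly_continuous_on T f -> 0 <= s -> s <= t -> t <= T ->
  (forall x, s <= x <= t -> `|f x - f s| <= e) ->
  `| \int[lebesgue_measure]_(x in `[0, t]) f x -
     \int[lebesgue_measure]_(x in `[0, s]) f x - f s * (t - s)| <= e * (t - s).
Proof.
move=> hf s0 st tT hx.
have it := uniformly_continuous_integrable hf tT.
have os : (BLeft (0 : R) <= BRight s)%O by rewrite bnd_simp.
have ot : (BRight s <= BRight t)%O by rewrite bnd_simp.
rewrite (Rintegral_itvB it os ot).
have ist : lebesgue_measure.-integrable `]s, t] (EFin \o f).
  by apply: integrableS it => //; apply: subset_itv; rewrite bnd_simp.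
have ic (c : R) : lebesgue_measure.-integrable `]s, t] (EFin \o (fun=> c)).
  have hc : uniformly_continuous_on T (fun=> c).
    by move=> r r0; exists 1 => // *; rewrite subrr normr0 ltW.
  apply: (integrableS _ _ _ (uniformly_continuous_integrable hc tT)) => //.
  by apply: subset_itv; rewrite bnd_simp.
have cE (c : R) : \int[lebesgue_measure]_(x in `]s, t]) c = c * (t - s).
  rewrite Rintegral_cst//= lebesgue_measure_itv/= lte_fin.
  case: ltP => //= h; have -> : t = s by apply/eqP; rewrite eq_le st h.
  by rewrite subrr.
suff : `|\int[lebesgue_measure]_(x in `]s, t]) f x -
    \int[lebesgue_measure]_(x in `]s, t]) f s| <=
    \int[lebesgue_measure]_(x in `]s, t]) e by rewrite !cE.
have isb : lebesgue_measure.-integrable `]s, t] (EFin \o (fun x => f x - f s)).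
  have : lebesgue_measure.-integrable `]s, t]
      ((EFin \o f) \- (EFin \o (fun=> f s)))%E by exact: integrableB.
  exact: eq_integrable.
rewrite -RintegralB//; apply: le_trans (le_normr_Rintegral _ _) _ => //.
apply: le_Rintegral => //; first exact: (integrable_norm isb).
by move=> x /=; rewrite in_itv/= => /andP[/ltW ? ?]; apply: hx; apply/andP.
Qed.

(** Over a stretch from [s] to [t] shorter than the modulus of continuity of [f],
    both the weighted sum and the integral are close to [f s] times the mass of the
    stretch, and the two masses are within [2 kappa] of each other.  Adding the
    about [k T] stretches of length [1/k] up to [t] bounds the difference by
    [e1 * (S t + t)] for the oscillation of [f], which does not depend on [k], plus
    a multiple of [k * kappa].  So [k] is fixed first, and [kappa], which [n]
    controls by [grid_sum_uniform], is chosen afterwards. *)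
Lemma weighted_grid_sum_uniform (w : nat -> nat -> R) f T M : 0 < T ->
  (forall n i, 0 <= w n i) ->
  (forall k q, (0 < k)%N ->
     grid_sum (w n) n (q%:R / k%:R) @[n --> \oo] --> (q%:R / k%:R : R)) ->
  uniformly_continuous_on T f -> (forall t, 0 <= t <= T -> `|f t| <= M) ->
  forall e, 0 < e -> \forall n \near \oo, forall t, 0 <= t <= T ->
    `|grid_sum (fun i => f (i.-1%:R / n%:R) * w n i) n t -
      \int[lebesgue_measure]_(x in `[0, t]) f x| <= e.
Proof.
move=> T0 w0 hw hf hM e e0.
have M0 : 0 <= M by apply: le_trans (hM 0 _) => //; rewrite lexx ltW.
pose e1 := e / 2 / (2 * T + 1).
have e10 : 0 < e1 by rewrite !divr_gt0// addr_gt0// mulr_gt0.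
have [eta eta0 heta] := hf _ e10.
have eta20 : 0 < eta / 2 by rewrite divr_gt0.
pose k := (Num.truncn (eta / 2)^-1).+1.
have kR : 0 < k%:R :> R by rewrite ltr0n.
have ke : k%:R^-1 <= eta / 2.
  rewrite invf_ple ?posrE//; apply: ltW.
  have h : 0 <= (eta / 2)^-1 by rewrite invr_ge0 ltW.
  by have /andP[] := truncn_itv h.
pose Q := (Num.truncn (k%:R * T)).+1.
(* At most Q stretches, each losing M * (2 * kappa) through the masses. *)
pose D := Q%:R * (M + 1) * 2.
have D0 : 0 < D by rewrite !mulr_gt0// ltr_wpDl.
pose kappa := Num.min 1 (e / 2 / D).
have kappa0 : 0 < kappa by rewrite lt_min ltr01 !divr_gt0.
near=> n.
have hS : forall t, 0 <= t <= T -> `|grid_sum (w n) n t - t| <= kappa.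
  near: n; apply: grid_sum_uniform => //; exact: ltW.
have n0 : (0 < n)%N by near: n; exists 1%N.
have nR : 0 < n%:R :> R by rewrite ltr0n.
have ne : n%:R^-1 <= eta / 2.
  near: n; exists (Num.truncn (eta / 2)^-1).+1 => // m /= hm.
  have m0 : 0 < m%:R :> R by rewrite ltr0n (leq_trans _ hm).
  rewrite invf_ple ?posrE//; apply: ltW.
  have h : 0 <= (eta / 2)^-1 by rewrite invr_ge0 ltW.
  have /andP[_ h'] := truncn_itv h; apply: lt_le_trans h' _.
  by rewrite ler_nat.
pose S t := grid_sum (w n) n t.
pose L t := grid_sum (fun i => f (i.-1%:R / n%:R) * w n i) n t.
pose I t := \int[lebesgue_measure]_(x in `[0, t]) f x.
pose Dl t := L t - I t.
have step s t : 0 <= s -> s <= t -> t <= T -> t - s <= k%:R^-1 ->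
    `|Dl t - Dl s| <= e1 * (S t - S s) + e1 * (t - s) + M * (2 * kappa).
  move=> s0 st tT ts; have sT := le_trans st tT; have t0 := le_trans s0 st.
  have h1 : `|L t - L s - f s * (S t - S s)| <= e1 * (S t - S s).
    rewrite /L /S !grid_sumB// !mulr_sumr -sumrB.
    apply: le_trans (ler_norm_sum _ _ _) _.
    apply: ler_sum_nat => i hi; have [gi1 gi2] := grid_index n0 t0 hi.
    rewrite -mulrBl normrM (ger0_norm (w0 _ _)) ler_wpM2r//.
    have gi3 : i.-1%:R / n%:R <= t.
      by apply: le_trans gi2; rewrite ler_pM2r ?invr_gt0// ler_nat leq_pred.
    apply: heta; first by rewrite s0.
      by rewrite divr_ge0//= (le_trans gi3).
    move: gi1 gi3 ts ke ne s0; clear.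
    move: (n%:R^-1) (k%:R^-1) (_ / _) => a b c *.
    by rewrite ler_norml; apply/andP; split; lra.
  have h2 : `|I t - I s - f s * (t - s)| <= e1 * (t - s).
    apply: (Rintegral_germ hf) => // x /andP[sx xt].
    apply: heta; rewrite ?s0 ?(le_trans s0 sx) ?(le_trans xt)//=.
    have := eta20; move: sx xt ts ke; clear; move: (k%:R^-1) => b *.
    by rewrite ler_norml; apply/andP; split; lra.
  have h3 : `|f s * (S t - S s - (t - s))| <= M * (2 * kappa).
    rewrite normrM; apply: ler_pM => //; first by apply: hM; rewrite s0.
    have := hS t; have := hS s; rewrite s0 sT t0 tT => /(_ isT) + /(_ isT).
    rewrite -/(S t) -/(S s) !ler_norml; clear => /andP[? ?] /andP[? ?].
    by apply/andP; split; lra.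
  rewrite (_ : Dl t - Dl s = (L t - L s - f s * (S t - S s)) +
    f s * (S t - S s - (t - s)) - (I t - I s - f s * (t - s))); last first.
    by rewrite /Dl; ring.
  set A := L t - _ - _ in h1 *; set B := f s * (_ - _) in h3 *.
  set C := I t - _ - _ in h2 *.
  have := ler_normB (A + B) C; have := ler_normD A B.
  by move: h1 h2 h3; clear; lra.
have I0 : I 0 = 0 by rewrite /I set_itv1 Rintegral_set1.
have S0 : S 0 = 0 by rewrite /S /grid_sum mulr0 truncn0 big_geq.
have L0 : L 0 = 0 by rewrite /L /grid_sum mulr0 truncn0 big_geq.
have claim p : p%:R / k%:R <= T ->
    `|Dl (p%:R / k%:R)| <= e1 * S (p%:R / k%:R) + e1 * (p%:R / k%:R) +
       p%:R * (M * (2 * kappa)).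
  elim: p => [|p IH] hp.
    by rewrite !mul0r /Dl S0 L0 I0 !mulr0 !addr0 subrr normr0.
  have hp' : p.+1%:R / k%:R = p%:R / k%:R + k%:R^-1 :> R.
    by rewrite -natr1 mulrDl mul1r.
  have k1 : 0 <= k%:R^-1 :> R by rewrite invr_ge0 ltW.
  have pk : 0 <= p%:R / k%:R :> R by rewrite divr_ge0.
  rewrite hp' in hp *; rewrite -natr1.
  move: (p%:R / k%:R : R) pk hp IH => y pk hp IH.
  move: (k%:R^-1 : R) k1 hp step => r k1 hp step.
  have yyr : y <= y + r by rewrite lerDl.
  have {}IH := IH (le_trans yyr hp).
  have := step y (y + r) pk yyr hp; rewrite addrAC subrr add0r lexx => /(_ isT).
  have := ler_normD (Dl (y + r) - Dl y) (Dl y); rewrite subrK.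
  by move: IH; clear; move: (M * (2 * kappa)) (p%:R : R) => a b; lra.
move=> t /andP[t0 tT].
have /truncn_itv/andP[] : 0 <= k%:R * t by rewrite mulr_ge0.
set p := Num.truncn (k%:R * t) => q1 q2.
have pQ : (p < Q)%N by rewrite /Q ltnS le_truncn// ler_wpM2l.
have a1 : p%:R / k%:R <= t by rewrite ler_pdivrMr// [leRHS]mulrC.
have a2 : t <= p.+1%:R / k%:R by rewrite ler_pdivlMr// [leLHS]mulrC ltW.
have pk : 0 <= p%:R / k%:R :> R by rewrite divr_ge0.
have a3 : p.+1%:R / k%:R = p%:R / k%:R + k%:R^-1 :> R.
  by rewrite -natr1 mulrDl mul1r.
have a4 : t - p%:R / k%:R <= k%:R^-1 by rewrite lerBlDl -a3.
have h1 := claim p (le_trans a1 tT).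
have h2 := step _ t pk a1 tT a4.
have h3 : p.+1%:R * (M * (2 * kappa)) <= e / 2.
  apply: (@le_trans _ _ (D * kappa)).
    rewrite /D -!mulrA; apply: ler_pM; rewrite ?ler_nat ?mulr_ge0//.
    + exact: ltW.
    + by rewrite ler_wpM2r ?mulr_ge0 ?lerDl// ltW.
  rewrite mulrC -ler_pdivlMr//; by rewrite /kappa ge_min lexx orbT.
have h4 : e1 * (S t + t) <= e / 2.
  rewrite /e1 mulrAC ler_pdivrMr; last by rewrite addr_gt0// mulr_gt0.
  apply: ler_wpM2l; first by rewrite divr_ge0// ltW.
  have := hS t; rewrite t0 tT => /(_ isT); rewrite -/(S t) ler_norml => /andP[_].
  have : kappa <= 1 by rewrite /kappa ge_min lexx.
  by move: tT; clear; lra.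
rewrite -/(L t) -/(I t) -/(Dl t).
have := ler_normD (Dl t - Dl (p%:R / k%:R)) (Dl (p%:R / k%:R)); rewrite subrK.
rewrite -natr1 in h3.
move: h1 h2 h3 h4; clear.
move: (p%:R / k%:R : R) => y; move: (M * (2 * kappa)) (p%:R : R) => a b.
by move: (S y) (S t) => *; lra.
Unshelve. all: by end_near. Qed.

End weighted_sums.

(** * The pathwise reduction *)

Section pathwise.
Context {R : realType}.
Implicit Types (u g : R -> R) (T b e : R).

Lemma powR_natN_small (p e : R) : 0 < p -> 0 < e ->
  \forall n \near \oo, (n%:R : R) `^ (- p) <= e.
Proof.
move=> p0 e0.
have z0 : 0 < e^-1 `^ p^-1 by rewrite powR_gt0// invr_gt0.
exists (Num.truncn (e^-1 `^ p^-1)).+1 => // n /= hn.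
have hz : e^-1 `^ p^-1 <= n%:R.
  have /andP[_ /ltW h] := truncn_itv (ltW z0).
  by apply: le_trans h _; rewrite ler_nat.
have n0 : 0 < (n%:R : R) by apply: lt_le_trans hz.
rewrite powRN invf_ple ?posrE ?powR_gt0//.
have -> : e^-1 = (e^-1 `^ p^-1) `^ p.
  by rewrite -powRrM mulVf ?gt_eqF// powRr1// invr_ge0 ltW.
by apply: ge0_ler_powR; rewrite ?nnegrE// ltW.
Qed.

Lemma holder_on_bounded T b u : 0 < T -> holder_on `[0, T] b u -> 0 < b ->
  exists2 M, 0 <= M & forall t, 0 <= t <= T -> `|u t| <= M.
Proof.
move=> T0 /holder_on_ge0[C C0 hC] b0.
exists (`|u 0| + C * T `^ b); first by rewrite addr_ge0// mulr_ge0// powR_ge0.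
move=> t /andP[t0 tT].
have : `|u t - u 0| <= C * T `^ b.
  apply: le_trans (hC _ _ _ _) _; rewrite /= ?in_itv/= ?lexx ?t0 ?tT//; first exact: ltW.
  rewrite ler_wpM2l// subr0 ger0_norm//.
  by apply: ge0_ler_powR; rewrite ?nnegrE// ltW.
have := ler_normD (u t - u 0) (u 0); rewrite subrK; lra.
Qed.

Lemma holder_on_sqr_uniformly_continuous T b u : 0 < T -> 0 < b -> holder_on `[0, T] b u ->
  uniformly_continuous_on T (fun t => `|u t| ^+ 2).
Proof.
move=> T0 b0 hu; have [M M0 hM] := holder_on_bounded T0 hu b0.
have [C C0 hC] := holder_on_ge0 hu.
move=> e e0; pose D := 2 * M * C + 1.
have D0 : 0 < D by rewrite ltr_wpDl// !mulr_ge0.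
have r0 : 0 < e / D by rewrite divr_gt0.
exists ((e / D) `^ b^-1); first exact: powR_gt0.
move=> s t hs ht hst.
have h1 : `|u t - u s| <= C * (e / D).
  apply: le_trans (hC s t hs ht) _; rewrite ler_wpM2l//.
  have -> : e / D = ((e / D) `^ b^-1) `^ b.
    by rewrite -powRrM mulVf ?gt_eqF// powRr1// ltW.
  by apply: ge0_ler_powR; rewrite ?nnegrE ?powR_ge0// ltW.
rewrite !real_normK ?num_real// subr_sqr normrM.
have h2 : `|u t + u s| <= 2 * M.
  have := ler_normD (u t) (u s); have := hM t ht; have := hM s hs; lra.
apply: (@le_trans _ _ (C * (e / D) * (2 * M))); first by rewrite ler_pM.
rewrite (_ : _ * _ = e * ((2 * M * C) / D)); last by ring.
rewrite ler_piMr ?(ltW e0)// ler_pdivrMr// mul1r /D; lra.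
Qed.

(** Young's inequality [2 |a r| <= l a^2 + r^2 / l] for the cross term, with
    [r = z - a].  The factor [l] can be taken small, so that the cross term needs no
    decay of its own. *)
Lemma sqr_perturbation (l z a : R) : 0 < l ->
  `|z ^+ 2 - a ^+ 2| <= l * a ^+ 2 + (1 + l^-1) * (z - a) ^+ 2.
Proof.
move=> l0; set r := z - a; have -> : z = a + r by rewrite /r; ring.
have il0 : 0 < l^-1 by rewrite invr_gt0.
have h1 : 0 <= l^-1 * (l * a - r) ^+ 2 by rewrite mulr_ge0 ?sqr_ge0// ltW.
have h2 : 0 <= l^-1 * (l * a + r) ^+ 2 by rewrite mulr_ge0 ?sqr_ge0// ltW.
have e1 : l^-1 * (l * a - r) ^+ 2 = l * a ^+ 2 - 2 * a * r + l^-1 * r ^+ 2.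
  by field; rewrite gt_eqF.
have e2 : l^-1 * (l * a + r) ^+ 2 = l * a ^+ 2 + 2 * a * r + l^-1 * r ^+ 2.
  by field; rewrite gt_eqF.
have h3 := sqr_ge0 r; have h4 : 0 <= l * a ^+ 2 by rewrite mulr_ge0 ?sqr_ge0// ltW.
rewrite (_ : (a + r) ^+ 2 - a ^+ 2 = 2 * a * r + r ^+ 2); last by ring.
have h5 : 0 <= l^-1 * r ^+ 2 by rewrite mulr_ge0 ?sqr_ge0// ltW.
rewrite e1 in h1; rewrite e2 in h2.
rewrite (_ : (1 + l^-1) * r ^+ 2 = r ^+ 2 + l^-1 * r ^+ 2); last by ring.
move: h1 h2 h3 h4 h5; move: (l * a ^+ 2) (l^-1 * r ^+ 2) (r ^+ 2) (2 * a * r).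
clear => A B C D *; rewrite ler_norml; apply/andP; split; lra.
Qed.

(** The pathwise statement.  By the local expansion of the Young integral, the
    increments of [RS_integral u g 0] are perturbations of
    [u_((i-1)/n) (g_(i/n) - g_((i-1)/n))] by [K n^-(b+d)]; their squares are compared
    by [sqr_perturbation], and the main part is a weighted sum. *)
Lemma quad_var_young_integral (H b d T : R) u g :
  H < 1 -> 0 < T -> 0 < b -> 0 < d -> 1 < b + d ->
  holder_on `[0, T] b u -> holder_on `[0, T] d g ->
  (forall k q, (0 < k)%N ->
     grid_sum (fun i => n%:R `^ (2 * H - 1) *
        (g (i%:R / n%:R) - g (i.-1%:R / n%:R)) ^+ 2) n (q%:R / k%:R)
       @[n --> \oo] --> (q%:R / k%:R : R)) ->
  forall e, 0 < e -> \forall n \near \oo, forall t, 0 <= t <= T ->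
    `|n%:R `^ (2 * H - 1) * quad_var n (RS_integral u g 0) t -
      \int[lebesgue_measure]_(s in `[0, t]) `|u s| ^+ 2| <= e.
Proof.
move=> H1 T0 b0 d0 bd1 hu hgd hw e e0.
have [Z [K K0 hZ]] := young_germ T0 b0 d0 bd1 hu hgd.
have [M M0 hM] := holder_on_bounded T0 hu b0.
have RSE t : 0 <= t -> t <= T -> RS_integral u g 0 t = Z t - Z 0.
  by move=> t0 tT; apply: (RS_integral_germ b0 d0 bd1 hu hgd hZ).
pose w n i := n%:R `^ (2 * H - 1) * (g (i%:R / n%:R) - g (i.-1%:R / n%:R)) ^+ 2.
pose f t := `|u t| ^+ 2.
have w0 n i : 0 <= w n i by rewrite mulr_ge0 ?powR_ge0// sqr_ge0.
have hf : uniformly_continuous_on T f by exact: holder_on_sqr_uniformly_continuous hu.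
have fM t : 0 <= t <= T -> `|f t| <= M ^+ 2.
  by move=> ht; rewrite ger0_norm ?sqr_ge0// lerXn2r ?nnegrE//; exact: hM.
have e30 : 0 < e / 3 by rewrite divr_gt0.
(* Three errors of at most e/3 each: the main part, the part l * a^2 of the
   perturbation (controlled by the choice of l), and the squared Young remainders
   (controlled by n). *)
pose B := M ^+ 2 * (T + 1) + 1.
have B0 : 0 < B by rewrite ltr_wpDl// mulr_ge0 ?sqr_ge0// addr_ge0 ?ltW.
pose l := e / 3 / B.
have l0 : 0 < l by rewrite divr_gt0.
pose A := (1 + l^-1) * K ^+ 2 * T + 1.
have li0 : 0 <= 1 + l^-1 by rewrite addr_ge0// invr_ge0 ltW.
have A0 : 0 < A by rewrite ltr_wpDl// !mulr_ge0 ?sqr_ge0// ltW.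
have p0 : 0 < 2 * (b + d) - 2 * H by rewrite -mulrBr mulr_gt0// subr_gt0 (lt_trans H1).
near=> n.
have n0 : (0 < n)%N by near: n; exists 1%N.
have nR : 0 < n%:R :> R by rewrite ltr0n.
have hmain : forall t, 0 <= t <= T ->
    `|grid_sum (fun i => f (i.-1%:R / n%:R) * w n i) n t -
      \int[lebesgue_measure]_(x in `[0, t]) f x| <= e / 3.
  by near: n; apply: weighted_grid_sum_uniform fM _ e30.
have hS : forall t, 0 <= t <= T -> `|grid_sum (w n) n t - t| <= 1.
  by near: n; apply: grid_sum_uniform => //; exact: ltW.
have hn : n%:R `^ (- (2 * (b + d) - 2 * H)) <= e / 3 / A.
  by near: n; apply: powR_natN_small => //; exact: divr_gt0.
move=> t /andP[t0 tT]; have ht : 0 <= t <= T by rewrite t0.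
pose N := Num.truncn (n%:R * t).
have NT : N%:R <= n%:R * T.
  by apply: (@le_trans _ _ (n%:R * t)); rewrite ?truncn_le ?mulr_ge0// ler_wpM2l.
pose c := n%:R `^ (2 * H - 1).
have c0 : 0 <= c by exact: powR_ge0.
have key i : (1 <= i < N.+1)%N ->
    `|c * `|RS_integral u g 0 (i%:R / n%:R) - RS_integral u g 0 (i.-1%:R / n%:R)| ^+ 2
       - f (i.-1%:R / n%:R) * w n i| <=
    l * M ^+ 2 * w n i + c * ((1 + l^-1) * K ^+ 2 * n%:R `^ (- (2 * (b + d)))).
  move=> /andP[i1 iN].
  have iT : i%:R / n%:R <= T.
    apply: le_trans tT; rewrite ler_pdivrMr// [leRHS]mulrC.
    by rewrite -truncn_ge_nat ?mulr_ge0.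
  have ii : i.-1%:R / n%:R <= i%:R / n%:R :> R.
    by rewrite ler_pM2r ?invr_gt0// ler_nat leq_pred.
  have i0 : 0 <= i.-1%:R / n%:R :> R by rewrite divr_ge0.
  have iD : i%:R / n%:R - i.-1%:R / n%:R = n%:R^-1 :> R.
    by rewrite -mulrBl -{1}(prednK i1) -natr1 addrAC subrr add0r mul1r.
  rewrite !RSE ?(le_trans i0)// ?(le_trans ii)//.
  have := hZ _ _ i0 ii iT; rewrite iD.
  move: hM => /(_ (i.-1%:R / n%:R)); rewrite i0 (le_trans ii iT) => /(_ isT) hMi.
  rewrite /w -/c /f; move: (u _) (g _) (g (i.-1%:R / n%:R)) (Z _) (Z (i.-1%:R / n%:R)) hMi.
  move=> U g1 g2 Z1 Z2 hMi hZi.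
  rewrite !real_normK ?num_real//.
  have sp := sqr_perturbation (Z1 - Z2) (U * (g1 - g2)) l0.
  rewrite (_ : _ - _ = c * ((Z1 - Z2) ^+ 2 - (U * (g1 - g2)) ^+ 2)); last by ring.
  rewrite normrM (ger0_norm c0).
  rewrite (_ : l * M ^+ 2 * _ + _ = c * (l * (M ^+ 2 * (g1 - g2) ^+ 2) +
     (1 + l^-1) * (K ^+ 2 * n%:R `^ (- (2 * (b + d)))))); last by ring.
  apply: ler_wpM2l => //; apply: le_trans sp _.
  apply: lerD; apply: ler_wpM2l => //; first exact: ltW.
    rewrite exprMn; apply: ler_wpM2r; first exact: sqr_ge0.
    by rewrite -[U ^+ 2]real_normK ?num_real// lerXn2r ?nnegrE.
  rewrite -[leLHS]real_normK ?num_real//.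
  have -> : K ^+ 2 * n%:R `^ (- (2 * (b + d))) = (K * n%:R^-1 `^ (b + d)) ^+ 2.
    rewrite exprMn; congr (_ * _).
    rewrite -powR_inv1 ?ltW// -powRrM mulN1r -powR_mulrn ?powR_ge0// -powRrM.
    congr powR; ring.
  rewrite lerXn2r ?nnegrE ?mulr_ge0 ?powR_ge0//.
have hdiff : `|c * quad_var n (RS_integral u g 0) t -
    grid_sum (fun i => f (i.-1%:R / n%:R) * w n i) n t| <=
    l * M ^+ 2 * grid_sum (w n) n t +
    N%:R * (c * ((1 + l^-1) * K ^+ 2 * n%:R `^ (- (2 * (b + d))))).
  rewrite /quad_var /grid_sum -/N !mulr_sumr -sumrB.
  have -> : N%:R * (c * ((1 + l^-1) * K ^+ 2 * n%:R `^ (- (2 * (b + d))))) =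
     \sum_(1 <= i < N.+1) c * ((1 + l^-1) * K ^+ 2 * n%:R `^ (- (2 * (b + d)))).
    by rewrite sumr_const_nat subn1 mulr_natl.
  rewrite -big_split/=; apply: le_trans (ler_norm_sum _ _ _) _.
  by apply: ler_sum_nat => i hi; exact: key.
have h1 : l * M ^+ 2 * grid_sum (w n) n t <= e / 3.
  have hSt : grid_sum (w n) n t <= T + 1.
    have := hS t ht; rewrite ler_norml => /andP[_]; move: tT; clear; lra.
  rewrite /l -mulrA mulrAC ler_pdivrMr//; apply: ler_wpM2l; first exact: ltW.
  apply: (@le_trans _ _ (M ^+ 2 * (T + 1))); last by rewrite /B lerDl.
  by apply: ler_wpM2l hSt; exact: sqr_ge0.
have h2 : N%:R * (c * ((1 + l^-1) * K ^+ 2 * n%:R `^ (- (2 * (b + d))))) <= e / 3.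
  have E : n%:R * (c * n%:R `^ (- (2 * (b + d)))) =
      n%:R `^ (- (2 * (b + d) - 2 * H)).
    rewrite /c -{1}[n%:R]powRr1// -!powRD ?pnatr_eq0 ?(gtn_eqF n0) ?implybT//.
    congr powR; ring.
  apply: (@le_trans _ _ (A * n%:R `^ (- (2 * (b + d) - 2 * H)))); last first.
    by rewrite mulrC -ler_pdivlMr.
  rewrite -E.
  apply: (@le_trans _ _ ((n%:R * T) * (c * ((1 + l^-1) * K ^+ 2 * n%:R `^ (- (2 * (b + d))))))).
    by apply: ler_wpM2r => //; rewrite !mulr_ge0 ?powR_ge0 ?sqr_ge0.
  rewrite (_ : n%:R * T * _ = ((1 + l^-1) * K ^+ 2 * T) *
    (n%:R * (c * n%:R `^ (- (2 * (b + d)))))); last by ring.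
  by apply: ler_wpM2r; rewrite ?mulr_ge0 ?powR_ge0// /A lerDl.
rewrite -/c; set I := Rintegral _ _ _; have := hmain t ht; rewrite -/I.
move: hdiff h1 h2; set X := grid_sum (fun i => _ * _) n t.
move: (_ * quad_var _ _ _) (l * _ * _) (N%:R * _) I X; clear => Q a q I X h h1 h2 h3.
have := ler_distD X Q I; lra.
Unshelve. all: by end_near. Qed.
End pathwise.

(** * Moments of the normal law *)

Section density.
Context {R : realType} {d : measure_display} {T : measurableType d}.
Variables (mu nu : {measure set T -> \bar R}) (h : T -> R).
Hypothesis mh : measurable_fun [set: T] h.
Hypothesis h0 : forall x, 0 <= h x.
Hypothesis nuE : forall A, measurable A -> nu A = (\int[mu]_(x in A) (h x)%:E)%E.

Import HBNNSimple.

Let density_nnsfun (f : {nnsfun T >-> R}) :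
  (\int[nu]_x (f x)%:E = \int[mu]_x ((f x)%:E * (h x)%:E))%E.
Proof.
under [LHS]eq_integral do rewrite fimfunE -fsumEFin//.
rewrite [LHS]ge0_integral_fsum//; last 2 first.
- by move=> r; exact/measurable_EFinP/measurableT_comp.
- by move=> n x _; rewrite EFinM nnfun_muleindic_ge0.
under [RHS]eq_integral.
  move=> x _; rewrite fimfunE -fsumEFin// ge0_mule_fsuml; last first.
    by move=> r; rewrite EFinM nnfun_muleindic_ge0.
  over.
rewrite [RHS]ge0_integral_fsum//; last 2 first.
- move=> r; apply: emeasurable_funM; last exact/measurable_EFinP.
  exact/measurable_EFinP/measurableT_comp.
- move=> r x _; apply: mule_ge0; last by rewrite lee_fin.
  by rewrite EFinM nnfun_muleindic_ge0.
apply: eq_fsbigr => r _.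
have mA : measurable (f @^-1` [set r]) by [].
rewrite integralZl_indic_nnsfun//= integral_indic// setIT nuE//.
have [r0|r0] := ltP r 0.
  have fr0 : f @^-1` [set r] = set0.
    by apply/seteqP; split => // x /= fx; move: r0; rewrite -fx ltNge fun_ge0.
  rewrite fr0 integral_set0 mule0; apply/esym; apply: integral0_eq => x _.
  by rewrite indic0/= mulr0 mul0e.
rewrite -ge0_integralZl//; last 2 first.
- by apply/measurable_EFinP; exact: measurable_funTS.
- by move=> x _; rewrite lee_fin.
rewrite integral_mkcond; apply: eq_integral => x _.
rewrite patchE indicE; case: ifP => _.
  by rewrite mulr1.
by rewrite mulr0 mul0e.
Qed.

(** Monotone approximation by simple functions, for which the formula is the
    definition of the density. *)
Lemma ge0_integral_density (f : T -> \bar R) :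
  measurable_fun [set: T] f -> (forall x, 0 <= f x)%E ->
  (\int[nu]_x f x = \int[mu]_x (f x * (h x)%:E))%E.
Proof.
move=> mf f0; pose f_ := nnsfun_approx measurableT mf.
transitivity (lim (\int[nu]_x (f_ n x)%:E @[n --> \oo])%E).
  rewrite -monotone_convergence//=.
  - apply: eq_integral => ? /[!inE] xD; apply/esym/cvg_lim => //=.
    exact: cvg_nnsfun_approx.
  - by move=> n; exact/measurable_EFinP/measurable_funTS.
  - by move=> n ? _; rewrite lee_fin.
  - by move=> ? _ ? ? mn; rewrite lee_fin; exact/lefP/nd_nnsfun_approx.
under eq_fun do rewrite density_nnsfun.
rewrite -monotone_convergence//=.
- apply: eq_integral => x _; apply/cvg_lim => //=.
  rewrite muleC; under eq_fun do rewrite muleC.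
  by apply: cvgeZl => //; exact: cvg_nnsfun_approx.
- move=> n; apply: emeasurable_funM; apply/measurable_EFinP => //.
- by move=> n x _; rewrite mule_ge0// lee_fin.
- move=> x _ m n mn; rewrite lee_pmul// lee_fin//; exact/lefP/nd_nnsfun_approx.
Qed.

Lemma integral_density (f : T -> R) : measurable_fun [set: T] f ->
  mu.-integrable [set: T] (EFin \o (fun x => f x * h x)) ->
  nu.-integrable [set: T] (EFin \o f) /\
  (\int[nu]_x (f x)%:E = \int[mu]_x (f x * h x)%:E)%E.
Proof.
move=> mf ifh.
have mef : measurable_fun [set: T] (EFin \o f) by exact/measurable_EFinP.
split.
  apply/integrableP; split => //.
  rewrite ge0_integral_density//; last exact: measurableT_comp.
  have /integrableP[_] := ifh; apply: le_lt_trans.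
  rewrite le_eqVlt; apply/orP; left; apply/eqP; apply: eq_integral => x _ /=.
  by rewrite normrM (ger0_norm (h0 x)).
rewrite [LHS]integralE [RHS]integralE.
congr (_ - _)%E.
  rewrite ge0_integral_density//; last exact: measurable_funepos.
  apply: eq_integral => x _; rewrite !funeposE -!EFin_max -EFinM; congr EFin.
  by rewrite maxr_pMl// mul0r.
rewrite ge0_integral_density//; last exact: measurable_funeneg.
apply: eq_integral => x _; rewrite !funenegE -!EFinN -!EFin_max -EFinM; congr EFin.
by rewrite maxr_pMl// mul0r mulNr.
Qed.
End density.

Section normal_moments.
Context {R : realType}.
Variables (m s : R).
Hypothesis s0 : s != 0.
Local Notation mu := (@lebesgue_measure R).
Local Notation pdf := (normal_pdf m s).

Definition normal_moment_fun (k : nat) (x : R) : R := (x - m) ^+ k * pdf x.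
Local Notation F := normal_moment_fun.

(** Half of the Gaussian exponent absorbs any polynomial, and the other half is the
    exponent of the normal density whose variance is twice as large. *)
Lemma normal_moment_fun_bound k : exists2 C, 0 <= C &
  forall x, `|F k x| <= C * normal_pdf m (s * Num.sqrt 2) x.
Proof.
have s20 : s * Num.sqrt 2 != 0 by rewrite mulf_neq0// gt_eqF// sqrtr_gt0.
have pk := normal_peak_gt0 s20.
pose C1 : R := 1 + (4 * s ^+ 2) ^+ k * k`!%:R.
have C10 : 0 <= C1 by rewrite addr_ge0// mulr_ge0// exprn_ge0// mulr_ge0// sqr_ge0.
exists (C1 * normal_peak s / normal_peak (s * Num.sqrt 2)).
  by rewrite divr_ge0 ?normal_peak_ge0// mulr_ge0 ?normal_peak_ge0.
move=> x; rewrite /F !normal_pdfE// /normal_fun.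
set z := x - m; pose v := z ^+ 2 / (4 * s ^+ 2).
have s2 : 0 < s ^+ 2 by rewrite exprn_even_gt0.
have v0 : 0 <= v by rewrite divr_ge0 ?sqr_ge0// mulr_ge0 ?sqr_ge0.
have -> : - z ^+ 2 / (s ^+ 2 *+ 2) = (- v) + (- v).
  by rewrite /v -mulr_natl; field; rewrite s0.
have -> : - z ^+ 2 / ((s * Num.sqrt 2) ^+ 2 *+ 2) = - v.
  by rewrite exprMn sqr_sqrtr// /v -mulr_natl; field; rewrite s0.
rewrite expRD [leRHS]mulrA divfK ?gt_eqF//.
rewrite !normrM (ger0_norm (normal_peak_ge0 _)) (ger0_norm (expR_ge0 _)).
rewrite (_ : `|z ^+ k| * _ = (`|z ^+ k| * expR (- v)) * (normal_peak s * expR (- v)));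
  last by ring.
rewrite -[leRHS]mulrA ler_wpM2r ?mulr_ge0 ?normal_peak_ge0 ?expR_ge0//.
rewrite expRN ler_pdivrMr ?expR_gt0//.
have ev1 : 1 <= expR v by rewrite -expR0 ler_expR.
have z2 : z ^+ 2 = 4 * s ^+ 2 * v.
  by rewrite /v; field; rewrite s0.
have zk : `|z| ^+ k <= 1 + (z ^+ 2) ^+ k.
  rewrite -real_normK ?num_real// -exprM mulnC exprM.
  have := sqr_ge0 (`|z| ^+ k - 2^-1); rewrite -normrX; nra.
have ek : v ^+ k <= k`!%:R * expR v.
  case: (k) => [|j]; first by rewrite expr0 fact0 mul1r.
  have := @expR_ge1Dxn _ v j v0; have f0 : 0 < (j.+1)`!%:R :> R by rewrite ltr0n fact_gt0.
  move=> H; rewrite mulrC -ler_pdivrMr//; apply: le_trans H; rewrite lerDr ler01 //.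
rewrite normrX; apply: le_trans zk _.
rewrite z2 [in leLHS]exprMn.
rewrite [leRHS](_ : _ = expR v + (4 * s ^+ 2) ^+ k * (k`!%:R * expR v)).
  by apply: lerD => //; apply: ler_wpM2l ek; rewrite exprn_ge0// mulr_ge0// sqr_ge0.
by rewrite /C1; ring.
Qed.

Lemma normal_moment_fun_measurable k : measurable_fun [set: R] (F k).
Proof.
apply: measurable_funM; last exact: measurable_normal_pdf.
by apply: measurable_funX; apply: measurable_funB.
Qed.

Lemma normal_moment_fun_integrable k : mu.-integrable [set: R] (EFin \o F k).
Proof.
have [C C0 hC] := normal_moment_fun_bound k.
have := integrable_normal_pdf m (s * Num.sqrt 2).
move=> /(integrableZl measurableT C); apply: le_integrable => //.
  by apply/measurable_EFinP; exact: normal_moment_fun_measurable.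
move=> x _ /=; rewrite lee_fin (le_trans (hC x))// ler_norm//.
Qed.

Lemma is_derive_normal_moment_fun (k : nat) (x : R) :
  is_derive x (1 : R) (F k : R -> R) (k%:R * F k.-1 x - F k.+1 x / s ^+ 2).
Proof.
have -> : F k = (fun x => (x - m) ^+ k * (normal_peak s * expR (- (x - m) ^+ 2 / (s ^+ 2 *+ 2)))).
  by apply/funext => y; rewrite /F normal_pdfE.
have d1 : is_derive x (1 : R) (fun x : R => x - m) 1.
  by apply: is_derive_eq; rewrite subr0.
have d2 : is_derive x (1 : R) (fun x : R => - (x - m) ^+ 2 / (s ^+ 2 *+ 2))
    (- (x - m) / s ^+ 2).
  apply: is_derive_eq; rewrite /GRing.scale/=; field.
  by rewrite s0.
have d3 : is_derive x (1 : R) (fun x : R => expR (- (x - m) ^+ 2 / (s ^+ 2 *+ 2)))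
    (expR (- (x - m) ^+ 2 / (s ^+ 2 *+ 2)) * (- (x - m) / s ^+ 2)).
  by apply: (@is_derive1_comp _ expR _ _ _ _ (is_derive_expR _) d2).
have d4 := is_deriveX k d1.
have d5 := is_deriveZ (normal_peak s) d3.
have d6 := is_deriveM d4 d5.
have -> : (fun x0 : R => (x0 - m) ^+ k *
     (normal_peak s * expR (- (x0 - m) ^+ 2 / (s ^+ 2 *+ 2)))) =
   ((fun x0 : R => x0 - m) ^+ k) *
   (normal_peak s \*: (fun x0 : R => expR (- (x0 - m) ^+ 2 / (s ^+ 2 *+ 2)))).
  by apply/funext => y; rewrite !fctE.
apply: (@is_derive_eq _ _ _ _ _ _ _ _ d6).
rewrite /F !normal_pdfE// /normal_fun !fctE /GRing.scale/= (exprS _ k).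
set E := expR _; rewrite [_ *: E](_ : _ = normal_peak s * E)//.
by field; rewrite s0.
Qed.

End normal_moments.

Section normal_moments_recursion.
Context {R : realType}.
Variables (m s : R).
Hypothesis s0 : s != 0.
Local Notation mu := (@lebesgue_measure R).
Local Notation F := (normal_moment_fun m s).

Lemma normal_moment_fun_continuous k : continuous (F k).
Proof.
move=> x; apply/differentiable_continuous/derivable1_diffP.
by have [] := is_derive_normal_moment_fun m s0 k x.
Qed.

(** [F k x * (x - m) = F k.+1 x] is bounded. *)
Lemma normal_moment_fun_decay k : exists2 D, 0 <= D & forall (n : nat) x,
  `|x - m| = n.+1%:R -> `|F k x| <= D * n.+1%:R^-1.
Proof.
have [C C0 hC] := normal_moment_fun_bound m s0 k.+1.
have s20 : s * Num.sqrt 2 != 0 by rewrite mulf_neq0// gt_eqF// sqrtr_gt0.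
exists (C * normal_peak (s * Num.sqrt 2)).
  by rewrite mulr_ge0// normal_peak_ge0.
move=> n x hx; rewrite ler_pdivlMr// -hx -normrM.
have -> : F k x * (x - m) = F k.+1 x.
  by rewrite /normal_moment_fun exprS; ring.
by apply: le_trans (hC x) _; rewrite ler_wpM2l// normal_pdf_ub.
Qed.

Let f k (x : R) : R := k%:R * F k.-1 x - F k.+1 x / s ^+ 2.

Let f_integrable k : mu.-integrable [set: R] (EFin \o f k).
Proof.
have := integrableB measurableT
  (integrableZl measurableT k%:R (normal_moment_fun_integrable m s0 k.-1))
  (integrableZl measurableT (s ^+ 2)^-1 (normal_moment_fun_integrable m s0 k.+1)).
apply: eq_integrable => // x _ /=.
by rewrite -!EFinM -EFinB /f; congr EFin; ring.
Qed.

(** The integrand is the derivative of [F k], which vanishes at infinity. *)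
Lemma integral_normal_moment_derive k : (\int[mu]_x (f k x)%:E = 0)%E.
Proof.
pose I n := `[m - n.+1%:R, m + n.+1%:R]%classic : set R.
pose g n := (EFin \o f k) \_ (I n).
have mf : measurable_fun [set: R] (EFin \o f k).
  by have /measurable_int := f_integrable k.
have lim1 : (\int[mu]_x g n x @[n --> \oo] --> \int[mu]_x (f k x)%:E)%E.
  apply: (@dominated_cvg _ _ _ mu _ measurableT g (EFin \o f k) (fun x => `|f k x|%:E)).
  - move=> n; apply/(@measurable_restrictT _ _ _ _ (I n) (EFin \o f k)) => //.
      by rewrite /I.
    exact: measurable_funTS.
  - move=> x _; apply: cvg_near_cst.
    exists (Num.truncn `|x - m|) => // n /= hn.
    rewrite /g patchE ifT// inE /I /= in_itv/=.
    have /andP[_ h] := truncn_itv (normr_ge0 (x - m)).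
    have : `|x - m| <= n.+1%:R.
      by apply: le_trans (ltW h) _; rewrite ler_nat ltnS.
    by rewrite ler_norml lerBlDl addrC => /andP[? ?]; apply/andP; split; lra.
  - by [].
  - by have /integrable_norm := f_integrable k.
  - move=> n x _; rewrite /g patchE; case: ifP => _; rewrite ?lee_fin//.
    by rewrite normr0.
have IE n : (\int[mu]_x g n x = (F k (m + n.+1%:R) - F k (m - n.+1%:R))%:E)%E.
  rewrite /g -integral_mkcond (@continuous_FTC2 _ (f k) (F k)) ?EFinB//.
  - by rewrite ltrD2l gtrN.
  - apply: continuous_subspaceT => x; apply: cvgB.
      by apply: cvgM; [exact: cvg_cst|exact: normal_moment_fun_continuous].
    by apply: cvgM; [exact: normal_moment_fun_continuous|exact: cvg_cst].
  - split.
    + by move=> x _; have [] := is_derive_normal_moment_fun m s0 k x.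
    + apply: cvg_at_right_filter; exact: normal_moment_fun_continuous.
    + apply: cvg_at_left_filter; exact: normal_moment_fun_continuous.
  - move=> x _; rewrite derive1E.
    by have [_ ->] := is_derive_normal_moment_fun m s0 k x.
have lim2 : (\int[mu]_x g n x @[n --> \oo] --> 0)%E.
  under eq_fun do rewrite IE.
  apply: cvg_EFin; first by near=> n.
  have [D D0 hD] := normal_moment_fun_decay k.
  apply/cvgr0Pnorm_le => e e0; near=> n => /=.
  have h1 : `|F k (m + n.+1%:R)| <= D * n.+1%:R^-1.
    by apply: hD; rewrite addrAC subrr add0r ger0_norm.
  have h2 : `|F k (m - n.+1%:R)| <= D * n.+1%:R^-1.
    by apply: hD; rewrite addrAC subrr add0r normrN ger0_norm.
  have hn : n.+1%:R^-1 <= e / (2 * (D + 1)).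
    near: n.
    have e'0 : 0 < e / (2 * (D + 1)).
      by rewrite divr_gt0// mulr_gt0// ltr_wpDl.
    near=> n; apply: ltW; near: n; exact: (@near_infty_natSinv_lt R (PosNum e'0)).
  have h3 : D * n.+1%:R^-1 <= e / 2.
    apply: le_trans (ler_wpM2l D0 hn) _.
    have -> : D * (e / (2 * (D + 1))) = e / 2 * (D / (D + 1)) by rewrite invfM; ring.
    rewrite ler_piMr ?divr_ge0 ?(ltW e0)// ler_pdivrMr ?ltr_wpDl//.
    by rewrite mul1r lerDl.
  apply: le_trans (ler_normB _ _) _; rewrite [e]splitr.
  by apply: lerD; apply: le_trans h3.
exact: (cvg_unique _ lim1 lim2).
Unshelve. all: by end_near. Qed.

Definition normal_moment k : R := \int[mu]_x F k x.

(** Integration by parts.  For [k = 0] this is the vanishing of the first central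
    moment. *)
Lemma normal_moment_rec k :
  normal_moment k.+1 = k%:R * s ^+ 2 * normal_moment k.-1.
Proof.
have : \int[mu]_x f k x = 0 by rewrite /Rintegral integral_normal_moment_derive.
have i1 := normal_moment_fun_integrable m s0 k.-1.
have i2 := normal_moment_fun_integrable m s0 k.+1.
rewrite /f RintegralB//=; last 2 first.
- have := integrableZl measurableT k%:R i1; exact: eq_integrable.
- have := integrableZr measurableT (s ^+ 2)^-1 i2; exact: eq_integrable.
rewrite RintegralZl// RintegralZr// -!/(normal_moment _) => /eqP.
rewrite subr_eq0 => /eqP /(congr1 (fun x => x * s ^+ 2)).
rewrite divfK ?expf_neq0// => <-; ring.
Qed.

Lemma normal_moment0 : normal_moment 0 = 1.
Proof.
rewrite /normal_moment /normal_moment_fun.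
under eq_Rintegral do rewrite expr0 mul1r.
by rewrite /Rintegral integral_normal_pdf.
Qed.

End normal_moments_recursion.

(** * Random variables with moments of all orders *)

Section moments.
Context {R : realType} {d : measure_display} {Omega : measurableType d}.
Variable P : probability Omega R.
Implicit Types (f g X Y : Omega -> R).

Definition Ex f : R := \int[P]_w f w.

Lemma ExE f : fine ('E_P[f])%E = Ex f.
Proof. by rewrite unlock. Qed.

(** An algebra of random variables on which the expectation is linear, so that
    integrability is proved once for all polynomials in Gaussian variables. *)
Definition all_moments f := measurable_fun [set: Omega] f /\
  forall p : nat, P.-integrable [set: Omega] (EFin \o (fun w => `|f w| ^+ p)).

Lemma all_moments_integrable f : all_moments f ->
  P.-integrable [set: Omega] (EFin \o f).
Proof.
move=> [mf /(_ 1%N)]; apply: le_integrable => //.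
  exact/measurable_EFinP.
by move=> w _ /=; rewrite expr1 lee_fin normr_id.
Qed.

Lemma all_moments_dominated f (g : nat -> Omega -> R) :
  measurable_fun [set: Omega] f ->
  (forall p, P.-integrable [set: Omega] (EFin \o g p)) ->
  (forall p w, `|f w| ^+ p <= g p w) -> all_moments f.
Proof.
move=> mf ig fg; split => // p; apply: le_integrable (ig p) => //.
  apply/measurable_EFinP; apply: measurable_funX.
  exact: measurableT_comp.
move=> w _ /=; rewrite lee_fin ger0_norm ?exprn_ge0//.
by apply: le_trans (fg p w) _; rewrite ler_norm.
Qed.

Lemma all_moments_cst c : all_moments (fun=> c).
Proof.
split=> [|p]; first exact: measurable_cst.
exact: (finite_measure_integrable_cst P (`|c| ^+ p)).
Qed.

Lemma all_momentsM f g : all_moments f -> all_moments g ->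
  all_moments (fun w => f w * g w).
Proof.
move=> [mf hf] [mg hg].
apply: (@all_moments_dominated _
  (fun p w => `|f w| ^+ (2 * p) + `|g w| ^+ (2 * p))).
- exact: measurable_funM.
- move=> p; have := integrableD measurableT (hf (2 * p)%N) (hg (2 * p)%N).
  exact: eq_integrable.
- move=> p w; rewrite normrM exprMn (mulnC 2) !exprM.
  have := sqr_ge0 (`|f w| ^+ p - `|g w| ^+ p).
  have := sqr_ge0 (`|f w| ^+ p); have := sqr_ge0 (`|g w| ^+ p).
  by move: (`|f w| ^+ p) (`|g w| ^+ p); clear => a b; nra.
Qed.

Lemma all_momentsZ c f : all_moments f -> all_moments (fun w => c * f w).
Proof. by move=> hf; apply: all_momentsM => //; exact: all_moments_cst. Qed.

Lemma exprnD_le (a b : R) p : 0 <= a -> 0 <= b ->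
  (a + b) ^+ p <= 2 ^+ p * (a ^+ p + b ^+ p).
Proof.
wlog ab : a b / a <= b.
  move=> h a0 b0; have [ab|/ltW ba] := leP a b; first exact: h.
  by rewrite addrC [X in _ * X]addrC; exact: h.
move=> a0 b0; apply: (@le_trans _ _ ((2 * b) ^+ p)).
  rewrite lerXn2r ?nnegrE ?addr_ge0 ?mulr_ge0//.
  by rewrite mulr_natl mulr2n lerD2r.
by rewrite exprMn ler_wpM2l ?exprn_ge0// lerDr exprn_ge0.
Qed.

Lemma all_momentsD f g : all_moments f -> all_moments g ->
  all_moments (fun w => f w + g w).
Proof.
move=> [mf hf] [mg hg].
apply: (@all_moments_dominated _
  (fun p w => 2 ^+ p * (`|f w| ^+ p + `|g w| ^+ p))).
- exact: measurable_funD.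
- move=> p; have := integrableZl measurableT (2 ^+ p)
    (integrableD measurableT (hf p) (hg p)).
  exact: eq_integrable.
- move=> p w; apply: le_trans (exprnD_le _ _ _) => //.
  by rewrite lerXn2r ?nnegrE ?addr_ge0// ler_normD.
Qed.

Lemma all_momentsB f g : all_moments f -> all_moments g ->
  all_moments (fun w => f w - g w).
Proof.
move=> hf hg; have := all_momentsD hf (all_momentsZ (-1) hg).
by under eq_fun do rewrite mulN1r.
Qed.

Lemma all_momentsX f n : all_moments f -> all_moments (fun w => f w ^+ n).
Proof.
move=> hf; elim: n => [|n IH].
  by under eq_fun do rewrite expr0; exact: all_moments_cst.
by under eq_fun do rewrite exprS; exact: all_momentsM.
Qed.

Lemma all_moments_sum (I : eqType) (r : seq I) (F : I -> Omega -> R) :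
  (forall i, i \in r -> all_moments (F i)) ->
  all_moments (fun w => \sum_(i <- r) F i w).
Proof.
elim: r => [|i r IH] h.
  by under eq_fun do rewrite big_nil; exact: all_moments_cst.
under eq_fun do rewrite big_cons; apply: all_momentsD.
  by apply: h; rewrite mem_head.
by apply: IH => j hj; apply: h; rewrite inE hj orbT.
Qed.

Lemma Ex_cst c : Ex (fun=> c) = c.
Proof.
rewrite /Ex Rintegral_cst//; have := @probability_setT _ _ _ P.
by move=> /= ->; rewrite mulr1.
Qed.

Lemma ExD f g : all_moments f -> all_moments g ->
  Ex (fun w => f w + g w) = Ex f + Ex g.
Proof.
by move=> /all_moments_integrable ? /all_moments_integrable ?; exact: RintegralD.
Qed.

Lemma ExZ c f : all_moments f -> Ex (fun w => c * f w) = c * Ex f.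
Proof. by move=> /all_moments_integrable ?; exact: RintegralZl. Qed.

Lemma ExB f g : all_moments f -> all_moments g ->
  Ex (fun w => f w - g w) = Ex f - Ex g.
Proof.
by move=> /all_moments_integrable ? /all_moments_integrable ?; exact: RintegralB.
Qed.

Lemma Ex_sum (I : eqType) (r : seq I) (F : I -> Omega -> R) :
  (forall i, i \in r -> all_moments (F i)) ->
  Ex (fun w => \sum_(i <- r) F i w) = \sum_(i <- r) Ex (F i).
Proof.
elim: r => [|i r IH] h.
  by under eq_fun do rewrite big_nil; rewrite Ex_cst big_nil.
under eq_fun do rewrite big_cons; rewrite big_cons ExD ?IH//.
- by move=> j hj; apply: h; rewrite inE hj orbT.
- by apply: h; rewrite mem_head.
- by apply: all_moments_sum => j hj; apply: h; rewrite inE hj orbT.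
Qed.

Lemma Ex_ge0 f : (forall w, 0 <= f w) -> 0 <= Ex f.
Proof. by move=> f0; apply: Rintegral_ge0. Qed.

Lemma Ex_le f g : all_moments f -> all_moments g ->
  (forall w, f w <= g w) -> Ex f <= Ex g.
Proof.
move=> /all_moments_integrable ? /all_moments_integrable ? fg.
exact: le_Rintegral.
Qed.

(** What the proof uses of a centered Gaussian variable: by this recursion its
    moments are those of a normal law, hence functions of its variance. *)
Definition gaussian_moments Y := [/\ all_moments Y, Ex Y = 0 &
  forall k, Ex (fun w => Y w ^+ k.+2) =
    k.+1%:R * Ex (fun w => Y w ^+ 2) * Ex (fun w => Y w ^+ k)].

Local Notation RR := (measurableTypeR R).

(** [RR] carries the same measurable sets as [R], in the form in which Lebesgue
    measure and the normal laws are defined. *)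
Lemma pushforward_moments (Y : Omega -> RR) (nu : {measure set RR -> \bar R})
    (g : RR -> R) :
  measurable_fun [set: Omega] Y ->
  (forall A, measurable A -> pushforward P Y A = nu A) ->
  measurable_fun [set: RR] g -> nu.-integrable [set: RR] (EFin \o g) ->
  P.-integrable [set: Omega] (EFin \o (fun w => g (Y w))) /\
  Ex (fun w => g (Y w)) = fine (\int[nu]_y (g y)%:E)%E.
Proof.
move=> mY hnu mg ig.
have igY : P.-integrable [set: Omega] (EFin \o (fun w => g (Y w))).
  apply/integrableP; split.
    by apply/measurable_EFinP; exact: measurableT_comp.
  have /integrableP[_] := ig.
  rewrite -(@eq_measure_integral _ _ _ _ nu (pushforward P Y)); last first.
    by move=> A mA _; exact: hnu.
  rewrite ge0_integral_pushforward//; last first.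
    by apply: measurableT_comp => //; exact/measurable_EFinP.
split=> //; rewrite /Ex /Rintegral; congr fine.
rewrite -(@eq_measure_integral _ _ _ _ nu (pushforward P Y)); last first.
  by move=> A mA _; exact: hnu.
rewrite integral_pushforward//; exact/measurable_EFinP.
Qed.

(** The law is a point mass or a normal law; the central moments of either satisfy
    the recursion, and centering forces the mean parameter [m] to be [0]. *)
Lemma gaussian_variable_moments Y : measurable_fun [set: Omega] Y ->
  gaussian_variable P Y -> ('E_P[Y] = 0)%E -> gaussian_moments Y.
Proof.
move=> mY [m [s [s0 hlaw]]] EY0.
have mY' : measurable_fun [set: Omega] (Y : Omega -> RR) by exact: mY.
have {}hlaw : forall A : set RR, measurable A ->
    pushforward P (Y : Omega -> RR) A = gaussian_law m s A by exact: hlaw.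
have [nu [hnu [inu [J0 J]]]] : exists nu : {measure set RR -> \bar R},
    (forall A, measurable A -> pushforward P Y A = nu A) /\
    (forall k, nu.-integrable [set: RR] (EFin \o (fun y : RR => (y - m) ^+ k))) /\
    fine (\int[nu]_(y in [set: RR]) ((y - m) ^+ 0)%:E)%E = 1 /\
    (forall k, fine (\int[nu]_(y in [set: RR]) ((y - m) ^+ k.+1)%:E)%E =
      k%:R * s ^+ 2 * fine (\int[nu]_(y in [set: RR]) ((y - m) ^+ k.-1)%:E)%E).
  have mg k : measurable_fun [set: RR] (fun y : RR => (y - m) ^+ k).
    by apply: measurable_funX; apply: measurable_funB.
  move: hlaw; rewrite /gaussian_law; case: eqVneq => [s00|sn0] hlaw.
    exists (dirac (m : RR)); split => //; split => [k|].
      apply/integrableP; split; first exact/measurable_EFinP.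
      rewrite integral_dirac//= ?diracT ?mul1e ?ltry//.
      by apply/measurable_EFinP; apply: measurableT_comp (mg k).
    have iE k : (\int[dirac (m : RR)]_(y in [set: RR]) ((y - m) ^+ k)%:E = (0 ^+ k)%:E)%E.
      rewrite integral_dirac ?diracT ?mul1e ?subrr//; exact/measurable_EFinP.
    split => [|k]; rewrite !iE /=; first by rewrite expr0.
    by rewrite s00 [0 ^+ 2]expr0n /= mulr0 mul0r exprS mul0r.
  exists (normal_prob m s : {measure set RR -> \bar R}); split => //.
  have dens k := @integral_density R _ RR lebesgue_measure (normal_prob m s) _
    (measurable_normal_pdf m s)
    (normal_pdf_ge0 m s) (fun A mA => erefl) _ (mg k)
    (normal_moment_fun_integrable m sn0 k).
  have dE k : fine (\int[normal_prob m s]_(y in [set: RR]) ((y - m) ^+ k)%:E)%E = normal_moment m s k.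
    by rewrite (dens k).2.
  split=> [k|]; first by have [] := dens k.
  by split=> [|k]; rewrite !dE ?normal_moment0// normal_moment_rec.
have mg k : measurable_fun [set: RR] (fun y : RR => (y - m) ^+ k).
  by apply: measurable_funX; apply: measurable_funB.
have hE k := pushforward_moments mY' hnu (mg k) (inu k).
have aYm : all_moments (fun w => Y w - m).
  split; first exact: measurable_funB.
  move=> p; have /integrable_norm := (hE p).1.
  by apply: eq_integrable => // w _ /=; rewrite normrX.
have YE : Y = fun w => (Y w - m) + m by apply/funext => w; rewrite subrK.
have aY : all_moments Y.
  by rewrite YE; apply: all_momentsD => //; exact: all_moments_cst.
have m0 : m = 0.
  have : Ex Y = 0 by rewrite -ExE EY0.
  rewrite {1}YE ExD//; last exact: all_moments_cst.
  rewrite Ex_cst; have := (hE 1%N).2; rewrite J mul0r mul0r.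
  by under eq_fun do rewrite expr1; move=> ->; rewrite add0r.
have {}hE k : Ex (fun w => Y w ^+ k) = fine (\int[nu]_y ((y - m) ^+ k)%:E)%E.
  by rewrite -(hE k).2; congr Ex; apply/funext => w; rewrite m0 subr0.
split=> // [|k].
  by rewrite -ExE EY0.
have -> : Ex (fun w => Y w ^+ 2) = s ^+ 2 by rewrite hE J J0 mulr1 mul1r.
by rewrite !hE J.
Qed.

End moments.

(** * The Wick formula *)

Section poly_ext.
Context {R : numDomainType}.
Lemma poly_ext (p q : {poly R}) : (forall t, p.[t] = q.[t]) -> p = q.
Proof.
move=> pq; apply/eqP; rewrite -subr_eq0; apply/negP => /negP n0.
pose r := [seq i%:R : R | i <- iota 0 (size (p - q))].
have : (size r < size (p - q)%R)%N.
  apply: max_poly_roots => //.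
    by apply/allP => _ /mapP[i _ ->]; rewrite rootE hornerD hornerN pq subrr.
  rewrite map_inj_uniq ?iota_uniq// => i j /eqP; rewrite eqr_nat => /eqP//.
by rewrite size_map size_iota ltnn.
Qed.
End poly_ext.

Section wick.
Context {R : realType} {d : measure_display} {Omega : measurableType d}.
Variable P : probability Omega R.
Local Notation rv := (Omega -> R).
Local Notation Ex := (Ex P).
Local Notation all_moments := (all_moments P).
Implicit Types (x y z F : rv) (s : seq rv).

Definition cov x y : R := Ex (fun w => x w * y w).

Lemma covC x y : cov x y = cov y x.
Proof. by rewrite /cov; congr Ex; apply/funext => w; rewrite mulrC. Qed.

Lemma cov_cauchy_schwarz x y : all_moments x -> all_moments y ->
  cov x y ^+ 2 <= cov x x * cov y y.
Proof.
move=> mx my.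
have mxy := all_momentsM mx my; have mxx := all_momentsM mx mx.
have myy := all_momentsM my my.
have quad a b : 0 <= a ^+ 2 * cov x x + 2 * a * b * cov x y + b ^+ 2 * cov y y.
  have -> : a ^+ 2 * cov x x + 2 * a * b * cov x y + b ^+ 2 * cov y y =
      Ex (fun w => (a * x w + b * y w) ^+ 2).
    have -> : (fun w => (a * x w + b * y w) ^+ 2) = fun w =>
        (a ^+ 2 * (x w * x w) + 2 * a * b * (x w * y w)) + b ^+ 2 * (y w * y w).
      by apply/funext => w; ring.
    rewrite !ExD ?ExZ//; repeat (apply: all_momentsD || apply: all_momentsZ) => //.
  by apply: Ex_ge0 => w; exact: sqr_ge0.
have cy0 : 0 <= cov y y by have := quad 0 1; rewrite expr0n/= expr1n; lra.
have [y0|y0] := eqVneq (cov y y) 0.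
  have cx0 : 0 <= cov x x by have := quad 1 0; rewrite expr0n/= expr1n; lra.
  rewrite y0 mulr0; have := quad (cov x y) (- (cov x x + 1)); rewrite y0.
  by move: (cov x x) (cov x y) cx0 => a b; clear => *; nra.
have := quad (cov y y) (- cov x y).
rewrite (_ : _ + _ = cov y y * (cov x x * cov y y - cov x y ^+ 2)); last by ring.
by rewrite pmulr_rge0 ?subr_ge0// lt_neqAle eq_sym y0.
Qed.

Lemma gaussian_moments_determined x y : gaussian_moments P x ->
  gaussian_moments P y -> Ex (fun w => x w ^+ 2) = Ex (fun w => y w ^+ 2) ->
  forall n, Ex (fun w => x w ^+ n) = Ex (fun w => y w ^+ n).
Proof.
move=> [_ x0 hx] [_ y0 hy] xy n.
suff [] : Ex (fun w => x w ^+ n) = Ex (fun w => y w ^+ n) /\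
  Ex (fun w => x w ^+ n.+1) = Ex (fun w => y w ^+ n.+1) by [].
elim: n => [|n [IH1 IH2]].
  split; first by congr Ex.
  by under eq_fun do rewrite expr1; under [in RHS]eq_fun do rewrite expr1; rewrite x0 y0.
by split=> //; rewrite hx hy xy IH1.
Qed.

(** The expectation of [(y + t z)^n F] as a polynomial in [t].  Identities valid for
    all real [t] are differentiated at [t = 0] by comparing coefficients. *)
Definition binom_poly y z n F : {poly R} :=
  \poly_(k < n.+1) ('C(n, k)%:R * Ex (fun w => y w ^+ (n - k) * z w ^+ k * F w)).

Lemma binom_polyE y z n F t : all_moments y -> all_moments z -> all_moments F ->
  (binom_poly y z n F).[t] = Ex (fun w => (y w + t * z w) ^+ n * F w).
Proof.
move=> my mz mF; rewrite horner_poly.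
have mt k : all_moments (fun w => y w ^+ (n - k) * z w ^+ k * F w).
  by apply: all_momentsM => //; apply: all_momentsM; apply: all_momentsX.
transitivity (Ex (fun w => \sum_(k <- index_enum 'I_n.+1)
    ('C(n, k)%:R * t ^+ k) * (y w ^+ (n - k) * z w ^+ k * F w))).
  rewrite Ex_sum => [|i _]; last exact: all_momentsZ.
  by apply: eq_bigr => k _; rewrite ExZ// mulrAC.
congr Ex; apply/funext => w; rewrite exprDn mulr_suml; apply: eq_bigr => k _.
by rewrite -mulr_natl exprMn; ring.
Qed.

Lemma binom_poly_coef0 y z n F :
  (binom_poly y z n F)`_0 = Ex (fun w => y w ^+ n * F w).
Proof.
rewrite coef_poly /= bin0 mul1r subn0; congr Ex; apply/funext => w.
by rewrite expr0 mulr1.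
Qed.

Lemma binom_poly_coef1 y z n F :
  (binom_poly y z n F)`_1 = n%:R * Ex (fun w => y w ^+ n.-1 * (z w * F w)).
Proof.
rewrite coef_poly; case: n => [|n] /=; first by rewrite mul0r.
rewrite bin1 subn1 /=; congr (_ * Ex _); apply/funext => w.
by rewrite expr1 mulrA.
Qed.

Variable L : rv -> Prop.
Hypothesis LD : forall x y t, L x -> L y -> L (fun w => x w + t * y w).
Hypothesis LG : forall x, L x -> gaussian_moments P x.

Let Lm x : L x -> all_moments x. Proof. by move=> /LG[]. Qed.

(** [y + t z] and [y - t z] have the same variance, hence the same moments; the
    coefficient of [t] in [E (y + t z)^(m+1)] must therefore vanish. *)
Lemma uncorrelated_moment y z m : L y -> L z -> cov y z = 0 ->
  Ex (fun w => y w ^+ m * z w) = 0.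
Proof.
move=> Ly Lz c0; have my := Lm Ly; have mz := Lm Lz.
have m1 := all_moments_cst P 1.
have var t : Ex (fun w => (y w + t * z w) ^+ 2) = cov y y + t ^+ 2 * cov z z.
  have -> : (fun w => (y w + t * z w) ^+ 2) = fun w =>
      (y w * y w + 2 * t * (y w * z w)) + t ^+ 2 * (z w * z w).
    by apply/funext => w; ring.
  have myy := all_momentsM my my; have mzz := all_momentsM mz mz.
  have myz := all_momentsM my mz.
  rewrite !ExD ?ExZ//; last 3 first.
  - by apply: all_momentsZ.
  - by apply: all_momentsD => //; apply: all_momentsZ.
  - by apply: all_momentsZ.
  by rewrite -![Ex _]/(cov _ _) c0 mulr0 addr0.
pose p := binom_poly y z m.+1 (fun=> 1).
have pE : p = p \Po (- 'X).
  apply: poly_ext => t; rewrite horner_comp hornerN hornerX !binom_polyE//.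
  under eq_fun do rewrite mulr1; under [in RHS]eq_fun do rewrite mulr1.
  apply: gaussian_moments_determined; [exact: LG (LD t Ly Lz)|exact: LG (LD (- t) Ly Lz)|].
  by rewrite !var sqrrN.
have : p`_1 = - p`_1.
  rewrite -[p`_1]mulr1n -coef_deriv -horner_coef0 {1}pE deriv_comp derivN derivX.
  by rewrite hornerM horner_comp !hornerN hornerX hornerC oppr0 mulrN1.
move=> /eqP; rewrite -subr_eq0 opprK -mulr2n mulrn_eq0/= binom_poly_coef1.
rewrite mulf_eq0 pnatr_eq0/= => /eqP <-; congr Ex; apply/funext => w.
by rewrite mulr1.
Qed.

(** Write [x = c y + z] with [z] uncorrelated to [y]: the part [c y] is governed by
    the moment recursion and the part [z] does not contribute. *)
Lemma power_stein x y m : L x -> L y ->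
  Ex (fun w => x w * y w ^+ m) = m%:R * cov x y * Ex (fun w => y w ^+ m.-1).
Proof.
move=> Lx Ly; have mx := Lm Lx; have my := Lm Ly.
have [y0|y0] := eqVneq (cov y y) 0.
  have c0 : cov y x = 0.
    have := cov_cauchy_schwarz my mx; rewrite y0 mul0r => h.
    by apply/eqP; rewrite -sqrf_eq0 eq_le h sqr_ge0.
  rewrite covC c0 mulr0 mul0r -[RHS](uncorrelated_moment m Ly Lx c0).
  by congr Ex; apply/funext => w; rewrite mulrC.
pose c := cov x y / cov y y.
pose z := fun w => x w + - c * y w.
have Lz : L z by exact: LD.
have mz := Lm Lz.
have c0 : cov y z = 0.
  rewrite /cov (_ : (fun w => _) = fun w => x w * y w + - c * (y w * y w)).
    rewrite ExD ?ExZ; [|exact: all_momentsM|exact: all_momentsM|exact/all_momentsZ/all_momentsM].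
    by rewrite -![Ex _]/(cov _ _) mulNr /c divfK ?subrr.
  by apply/funext => w; rewrite /z; ring.
have -> : (fun w => x w * y w ^+ m) = fun w => c * (y w ^+ m.+1) + y w ^+ m * z w.
  by apply/funext => w; rewrite /z exprS; ring.
rewrite ExD ?ExZ ?(uncorrelated_moment m Ly Lz c0) ?addr0; last 3 first.
- exact: all_momentsX.
- exact/all_momentsZ/all_momentsX.
- by apply: all_momentsM => //; apply: all_momentsX.
have [_ Ey0 yrec] := LG Ly.
case: m => [|m].
  by under eq_fun do rewrite expr1; rewrite Ey0 mulr0 mul0r mul0r.
rewrite yrec /=.
have -> : Ex (fun w => y w ^+ 2) = cov y y by [].
rewrite /c; move: (Ex _) => E; field; exact: y0.
Qed.

Definition prodrv s : rv := fun w => \prod_(y <- s) y w.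

(** Stated through [nth], as functions have no decidable equality. *)
Definition Lseq s := forall i, (i < size s)%N -> L (nth (fun=> 0) s i).

Definition rem_nth i s := take i s ++ drop i.+1 s.

Lemma Lseq_cons x s : Lseq (x :: s) -> L x /\ Lseq s.
Proof. by move=> h; split=> [|i hi]; [exact: (h 0%N)|exact: (h i.+1)]. Qed.

Lemma Lseq_rem i s : Lseq s -> Lseq (rem_nth i s).
Proof.
elim: s i => [|x s IH] [|i] //=; rewrite /rem_nth/=.
- by rewrite drop0 => /Lseq_cons[].
- by move=> /Lseq_cons[Lx Ls] [|j] //= hj; exact: (IH i Ls j hj).
Qed.

Lemma all_moments_prodrv s : Lseq s -> all_moments (prodrv s).
Proof.
elim: s => [|x s IH] h; rewrite /prodrv.
  by under eq_fun do rewrite big_nil; exact: all_moments_cst.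
under eq_fun do rewrite big_cons; have [Lx Ls] := Lseq_cons h.
by apply: all_momentsM; [exact: Lm|exact: IH].
Qed.

(** Gaussian integration by parts for [y^m] times a product.  To insert a new factor
    [z], apply the statement to [y + t z] with exponent [m + 1] and take the
    coefficient of [t]: differentiating the power of [y] produces the factor. *)
Lemma stein_prod s x y m : L x -> L y -> Lseq s ->
  Ex (fun w => y w ^+ m * (x w * prodrv s w)) =
  m%:R * cov x y * Ex (fun w => y w ^+ m.-1 * prodrv s w) +
  \sum_(i < size s) cov x (nth (fun=> 0) s i) *
     Ex (fun w => y w ^+ m * prodrv (rem_nth i s) w).
Proof.
elim: s x y m => [|z s IH] x y m Lx Ly Ls.
  rewrite big_ord0 addr0; transitivity (Ex (fun w => x w * y w ^+ m)).
    by congr Ex; apply/funext => w; rewrite /prodrv big_nil mulr1 mulrC.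
  rewrite power_stein//; congr (_ * Ex _); apply/funext => w.
  by rewrite /prodrv big_nil mulr1.
have [Lz Ls'] := Lseq_cons Ls.
have mx := Lm Lx; have my := Lm Ly; have mz := Lm Lz.
have ms := all_moments_prodrv Ls'.
have mr i := all_moments_prodrv (@Lseq_rem i s Ls').
have myz t : all_moments (fun w => y w + t * z w).
  by apply: all_momentsD => //; exact: all_momentsZ.
pose xs w := x w * prodrv s w.
have mxs : all_moments xs by exact: all_momentsM.
have key : binom_poly y z m.+1 xs =
    (m.+1%:R * cov x y) *: binom_poly y z m (prodrv s) +
    (m.+1%:R * cov x z) *: ('X * binom_poly y z m (prodrv s)) +
    \sum_(i < size s) cov x (nth (fun=> 0) s i) *:
       binom_poly y z m.+1 (prodrv (rem_nth i s)).
  apply: poly_ext => t; rewrite hornerD hornerD !hornerZ hornerM hornerX.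
  rewrite horner_sum; under eq_bigr do rewrite hornerZ binom_polyE//.
  rewrite !binom_polyE// IH//; last exact: LD.
  congr (_ + _); rewrite /= mulrA -!mulrDl; congr (_ * _).
  have -> : cov x (fun w => y w + t * z w) = cov x y + t * cov x z.
    rewrite /cov -ExZ; last exact: all_momentsM.
    rewrite -ExD; [|exact: all_momentsM|exact/all_momentsZ/all_momentsM].
    by congr Ex; apply/funext => w; ring.
  ring.
have E : (binom_poly y z m.+1 xs)`_1 =
    m.+1%:R * cov x y * (binom_poly y z m (prodrv s))`_1 +
    m.+1%:R * cov x z * (binom_poly y z m (prodrv s))`_0 +
    \sum_(i < size s) cov x (nth (fun=> 0) s i) *
       (binom_poly y z m.+1 (prodrv (rem_nth i s)))`_1.
  rewrite key !coefD !coefZ coefXM /= coef_sum; congr (_ + _).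
  by apply: eq_bigr => i _; rewrite coefZ.
rewrite !binom_poly_coef1 binom_poly_coef0 /= in E.
apply: (@mulfI _ m.+1%:R); first by rewrite pnatr_eq0.
have zE k r : (fun w => y w ^+ k * (z w * prodrv r w)) =
    fun w => y w ^+ k * prodrv (z :: r) w.
  by apply/funext => w; rewrite /prodrv big_cons.
rewrite big_ord_recl /= /rem_nth /= drop0.
transitivity (m.+1%:R * Ex (fun w => y w ^+ m * (z w * xs w))).
  congr (_ * Ex _); apply/funext => w.
  by rewrite /xs /prodrv big_cons; ring.
rewrite E mulrDr [_ * (_ + \sum_(i < _) _)]mulrDr addrA; congr (_ + _).
  by congr (_ + _); rewrite ?zE; ring.
rewrite mulr_sumr; apply: eq_bigr => i _; rewrite binom_poly_coef1 zE /=; ring.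
Qed.

(** The Wick (Isserlis) formula in recursive form: the case [m = 0] of
    [stein_prod]. *)
Lemma wick x s : L x -> Lseq s -> Ex (prodrv (x :: s)) =
  \sum_(i < size s) cov x (nth (fun=> 0) s i) * Ex (prodrv (rem_nth i s)).
Proof.
move=> Lx Ls; have := stein_prod 0 Lx Lx Ls; rewrite !mul0r add0r => E.
rewrite -(_ : Ex (fun w => x w ^+ 0 * (x w * prodrv s w)) = Ex (prodrv (x :: s))).
  rewrite E; apply: eq_bigr => i _; congr (_ * Ex _); apply/funext => w.
  by rewrite expr0 mul1r.
by congr Ex; apply/funext => w; rewrite expr0 mul1r /prodrv big_cons.
Qed.

End wick.

(** * Fourth moments in the second chaos *)

Section chaos.
Context {R : realType} {d : measure_display} {Omega : measurableType d}.
Variable P : probability Omega R.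
Local Notation rv := (Omega -> R).
Local Notation Ex := (Ex P).
Local Notation all_moments := (all_moments P).
Local Notation cov := (cov P).
Implicit Types (x y z F : rv) (s : seq rv).
Variable L : rv -> Prop.
Hypothesis LD : forall x y t, L x -> L y -> L (fun w => x w + t * y w).
Hypothesis LG : forall x, L x -> gaussian_moments P x.

(** The sum over all partners [y] in [s] of [x], [pre] being the list of the
    elements already passed; together with [wick_sum] it evaluates the Wick formula
    by computation on explicit lists. *)
Fixpoint wick_split (f : seq rv -> R) x (pre s : seq rv) : R :=
  if s is y :: s' then cov x y * f (pre ++ s') + wick_split f x (rcons pre y) s'
  else 0.

Fixpoint wick_sum n s : R :=
  match n, s with
  | _, [::] => 1
  | n.+1, x :: s' => wick_split (wick_sum n) x [::] s'
  | 0, _ => 0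
  end.

Lemma wick_splitE f x pre s : wick_split f x pre s =
  \sum_(i < size s) cov x (nth (fun=> 0) s i) * f (pre ++ rem_nth i s).
Proof.
elim: s pre => [|y s IH] pre /=; first by rewrite big_ord0.
rewrite big_ord_recl /= /rem_nth /= drop0 IH; congr (_ + _).
by apply: eq_bigr => i _; rewrite cat_rcons.
Qed.

Lemma size_rem_nth i s : (i < size s)%N -> size (rem_nth i s) = (size s).-1.
Proof. by move=> hi; rewrite size_cat size_take hi size_drop; lia. Qed.

Lemma wick_sumE n s : (size s <= n)%N -> Lseq L s -> Ex (prodrv s) = wick_sum n s.
Proof.
elim: n s => [|n IH] [|x s] //= hs Ls; last 1 first.
  have [Lx Ls'] := Lseq_cons Ls.
  rewrite (wick LD LG)// wick_splitE; apply: eq_bigr => i _.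
  rewrite /= IH//; last exact: Lseq_rem.
  by rewrite size_rem_nth//; lia.
- by rewrite /prodrv; under eq_fun do rewrite big_nil; rewrite Ex_cst.
- by rewrite /prodrv; under eq_fun do rewrite big_nil; rewrite Ex_cst.
Qed.

Definition centered_sqr x : rv := fun w => x w ^+ 2 - cov x x.

Lemma all_moments_centered_sqr x : L x -> all_moments (centered_sqr x).
Proof.
move=> /LG[mx _ _]; apply: all_momentsB; last exact: all_moments_cst.
exact: all_momentsX.
Qed.

Lemma all_moments_prod_sqr r : Lseq L r ->
  all_moments (fun w => \prod_(x <- r) centered_sqr x w).
Proof.
elim: r => [|x r IH] h.
  by under eq_fun do rewrite big_nil; exact: all_moments_cst.
under eq_fun do rewrite big_cons; have [Lx Ls] := Lseq_cons h.
by apply: all_momentsM; [exact: all_moments_centered_sqr|exact: IH].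
Qed.

(** Expanding one factor [x^2 - E x^2] moves it into a plain product, to which the
    Wick formula applies. *)
Lemma centered_sqr_rec x r s : L x -> Lseq L r -> Lseq L s ->
  Ex (fun w => (\prod_(y <- x :: r) centered_sqr y w) * prodrv s w) =
  Ex (fun w => (\prod_(y <- r) centered_sqr y w) * prodrv (x :: x :: s) w) -
  cov x x * Ex (fun w => (\prod_(y <- r) centered_sqr y w) * prodrv s w).
Proof.
move=> Lx Lr Ls.
have [mx _ _] := LG Lx.
have mr := all_moments_prod_sqr Lr.
have ms := all_moments_prodrv LG Ls.
rewrite -ExZ; last exact: all_momentsM.
rewrite -ExB; last 2 first.
- apply: all_momentsM => //; rewrite /prodrv; under eq_fun do rewrite !big_cons.
  by apply: all_momentsM => //; apply: all_momentsM.
- by apply: all_momentsZ; apply: all_momentsM.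
congr Ex; apply/funext => w; rewrite /prodrv !big_cons /centered_sqr; ring.
Qed.

Fixpoint chaos_sum n r s : R :=
  if r is x :: r' then chaos_sum n r' (x :: x :: s) - cov x x * chaos_sum n r' s
  else wick_sum n s.

Lemma chaos_sumE n r s : (size r + size r + size s <= n)%N ->
  Lseq L r -> Lseq L s ->
  Ex (fun w => (\prod_(y <- r) centered_sqr y w) * prodrv s w) = chaos_sum n r s.
Proof.
elim: r s => [|x r IH] s /= hn Lr Ls.
  rewrite -wick_sumE//; congr Ex; apply/funext => w.
  by rewrite big_nil mul1r.
have [Lx Lr'] := Lseq_cons Lr.
have h1 : (size r + size r + size [:: x, x & s] <= n)%N.
  by move: hn => /=; clear; lia.
have h2 : (size r + size r + size s <= n)%N by move: hn; clear; lia.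
rewrite centered_sqr_rec// !IH//.
by move=> [|[|i]] //= hi; exact: Ls.
Qed.

(** Of the 105 pairings of the eight factors those which pair some [x_i] with itself
    cancel; the 60 others are 12 products of two double edges and 48 four-cycles. *)
Lemma centered_sqr4 x1 x2 x3 x4 : L x1 -> L x2 -> L x3 -> L x4 ->
  Ex (fun w => centered_sqr x1 w * centered_sqr x2 w * centered_sqr x3 w *
      centered_sqr x4 w) =
  4 * (cov x1 x2 ^+ 2 * cov x3 x4 ^+ 2 + cov x1 x3 ^+ 2 * cov x2 x4 ^+ 2 +
       cov x1 x4 ^+ 2 * cov x2 x3 ^+ 2) +
  16 * (cov x1 x2 * cov x2 x3 * cov x3 x4 * cov x1 x4 +
        cov x1 x2 * cov x2 x4 * cov x3 x4 * cov x1 x3 +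
        cov x1 x3 * cov x2 x3 * cov x2 x4 * cov x1 x4).
Proof.
move=> L1 L2 L3 L4.
have Lr : Lseq L [:: x4; x3; x2; x1] by case=> [|[|[|[|]]]].
have -> : (fun w => centered_sqr x1 w * centered_sqr x2 w * centered_sqr x3 w *
      centered_sqr x4 w) =
   fun w => (\prod_(y <- [:: x4; x3; x2; x1]) centered_sqr y w) * prodrv [::] w.
  by apply/funext => w; rewrite /prodrv !big_cons !big_nil; ring.
rewrite (@chaos_sumE 8)// /chaos_sum /wick_sum /wick_split /=.
move: (cov x1 x1) (cov x2 x2) (cov x3 x3) (cov x4 x4) (cov x1 x2) (cov x1 x3).
move: (cov x1 x4) (cov x2 x3) (cov x2 x4) (cov x3 x4); clear => *.
ring.
Qed.

(** A four-cycle is a product of two of the quantities whose squares appear, so it is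
    bounded by their mean: the difference is a sum of three squares. *)
Lemma centered_sqr4_le x1 x2 x3 x4 : L x1 -> L x2 -> L x3 -> L x4 ->
  Ex (fun w => centered_sqr x1 w * centered_sqr x2 w * centered_sqr x3 w *
      centered_sqr x4 w) <=
  20 * (cov x1 x2 ^+ 2 * cov x3 x4 ^+ 2 + cov x1 x3 ^+ 2 * cov x2 x4 ^+ 2 +
       cov x1 x4 ^+ 2 * cov x2 x3 ^+ 2).
Proof.
move=> L1 L2 L3 L4; rewrite centered_sqr4//.
move: (cov x1 x2) (cov x1 x3) (cov x1 x4) (cov x2 x3) (cov x2 x4) (cov x3 x4).
clear => a b c e f g.
have h1 := sqr_ge0 (a * g - c * e); have h2 := sqr_ge0 (a * g - b * f).
have h3 := sqr_ge0 (b * f - c * e).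
rewrite -subr_ge0.
rewrite (_ : _ - _ = 8 * ((a * g - c * e) ^+ 2 + (a * g - b * f) ^+ 2 +
  (b * f - c * e) ^+ 2)); last by ring.
by rewrite mulr_ge0// !addr_ge0.
Qed.

(** Each of the three pairings of the four summation indices contributes the square
    of the sum of the squared covariances. *)
Lemma chaos_fourth_moment (N : nat) (X : 'I_N -> rv) : (forall i, L (X i)) ->
  Ex (fun w => (\sum_i centered_sqr (X i) w) ^+ 4) <=
  60 * (\sum_i \sum_j cov (X i) (X j) ^+ 2) ^+ 2.
Proof.
move=> LX; have mq i := all_moments_centered_sqr (LX i).
have mq4 i j k l : all_moments (fun w => centered_sqr (X i) w * centered_sqr (X j) w *
    centered_sqr (X k) w * centered_sqr (X l) w).
  by repeat apply: all_momentsM.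
have -> : (fun w => (\sum_i centered_sqr (X i) w) ^+ 4) = fun w =>
   \sum_(p : ('I_N * 'I_N) * ('I_N * 'I_N)) centered_sqr (X p.1.1) w *
     centered_sqr (X p.1.2) w * centered_sqr (X p.2.1) w * centered_sqr (X p.2.2) w.
  apply/funext => w.
  rewrite (_ : _ ^+ 4 =
    ((\sum_i centered_sqr (X i) w) * (\sum_i centered_sqr (X i) w)) *
    ((\sum_i centered_sqr (X i) w) * (\sum_i centered_sqr (X i) w))); last by ring.
  rewrite big_distrlr /= pair_big /= big_distrlr /= pair_big /=.
  by apply: eq_bigr => p _; ring.
rewrite Ex_sum => [|p _]; last exact: mq4.
apply: (@le_trans _ _ (\sum_(p : ('I_N * 'I_N) * ('I_N * 'I_N))
  20 * (cov (X p.1.1) (X p.1.2) ^+ 2 * cov (X p.2.1) (X p.2.2) ^+ 2 +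
        cov (X p.1.1) (X p.2.1) ^+ 2 * cov (X p.1.2) (X p.2.2) ^+ 2 +
        cov (X p.1.1) (X p.2.2) ^+ 2 * cov (X p.1.2) (X p.2.1) ^+ 2))).
  by apply: ler_sum => p _; exact: centered_sqr4_le.
rewrite -mulr_sumr !big_split /=.
set A := \sum_i \sum_j _.
have AE : A = \sum_(p : 'I_N * 'I_N) cov (X p.1) (X p.2) ^+ 2.
  by rewrite /A pair_big.
have E1 : \sum_(p : ('I_N * 'I_N) * ('I_N * 'I_N))
    cov (X p.1.1) (X p.1.2) ^+ 2 * cov (X p.2.1) (X p.2.2) ^+ 2 = A ^+ 2.
  by rewrite expr2 {1}AE AE big_distrlr /= pair_big.
have E2 : \sum_(p : ('I_N * 'I_N) * ('I_N * 'I_N))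
    cov (X p.1.1) (X p.2.1) ^+ 2 * cov (X p.1.2) (X p.2.2) ^+ 2 = A ^+ 2.
  rewrite -E1.
  pose h (p : ('I_N * 'I_N) * ('I_N * 'I_N)) := ((p.1.1, p.2.1), (p.1.2, p.2.2)).
  by rewrite (reindex h) //=; apply: onW_bij; exists h; case=> [[? ?] [? ?]].
have E3 : \sum_(p : ('I_N * 'I_N) * ('I_N * 'I_N))
    cov (X p.1.1) (X p.2.2) ^+ 2 * cov (X p.1.2) (X p.2.1) ^+ 2 = A ^+ 2.
  rewrite -E2.
  pose h (p : ('I_N * 'I_N) * ('I_N * 'I_N)) := (p.1, (p.2.2, p.2.1)).
  by rewrite (reindex h) //=; apply: onW_bij; exists h; case=> [[? ?] [? ?]].
rewrite E1 E2 E3 le_eqVlt; apply/orP; left; apply/eqP; ring.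
Qed.

End chaos.

(** * The linear span of the process *)

(** Truncation at level 6 loses at most [y^2 / 6], which for the normalised square of
    a Gaussian variable, whose second moment is 3, has expectation 1/2. *)
Lemma le_min_sqr {R : realFieldType} (y : R) : 0 <= y ->
  y <= Num.min y 6 + 6^-1 * y ^+ 2.
Proof.
move=> y0; case: (leP y 6) => h; first by have := sqr_ge0 y; lra.
nra.
Qed.

Section gaussian_process_space.
Context {R : realType} {d : measure_display} {Omega : measurableType d}.
Variable P : probability Omega R.
Local Notation rv := (Omega -> R).
Local Notation Ex := (Ex P).
Local Notation all_moments := (all_moments P).
Local Notation cov := (cov P).
Variable G : R -> Omega -> R.

Definition linear_span (y : rv) : Prop :=
  exists k (t a : 'I_k -> R), (forall i, 0 <= t i) /\
    y = fun w => \sum_(i < k) a i * G (t i) w.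

Lemma linear_span_comb x y c : linear_span x -> linear_span y ->
  linear_span (fun w => x w + c * y w).
Proof.
move=> [k [t [a [t0 ->]]]] [k' [t' [a' [t'0 ->]]]].
exists (k + k')%N.
exists (fun i => match fintype.split i with inl j => t j | inr j => t' j end).
exists (fun i => match fintype.split i with inl j => a j | inr j => c * a' j end).
split=> [i|]; first by case: (fintype.split i).
apply/funext => w; rewrite big_split_ord/= mulr_sumr; congr (_ + _).
  by apply: eq_bigr => i _; rewrite (unsplitK (inl i)).
by apply: eq_bigr => i _; rewrite (unsplitK (inr i)) mulrA.
Qed.

Lemma linear_span_point t : 0 <= t -> linear_span (G t).
Proof.
move=> t0; exists 1%N, (fun=> t), (fun=> 1); split => //.
by apply/funext => w; rewrite big_ord1 mul1r.
Qed.

Definition increment s t : rv := fun w => G t w - G s w.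

Lemma linear_span_increment s t : 0 <= s -> 0 <= t -> linear_span (increment s t).
Proof.
move=> s0 t0.
have := linear_span_comb (-1) (linear_span_point t0) (linear_span_point s0).
by under eq_fun do rewrite mulN1r.
Qed.

Hypothesis gaussG : gaussian_process P `[0, +oo[ G.
Hypothesis centeredG : centered P `[0, +oo[ G.

Lemma measurable_linear_span y : linear_span y -> measurable_fun [set: Omega] y.
Proof.
move=> [k [t [a [t0 ->]]]]; have [mG _] := gaussG.
apply: measurable_sum => i; apply: measurable_funM => //.
by apply: mG; rewrite /= in_itv/= t0.
Qed.

Lemma gaussian_linear_span y : linear_span y -> gaussian_variable P y.
Proof.
move=> [k [t [a [t0 ->]]]]; have [_ gG] := gaussG.
by apply: gG => i; rewrite /= in_itv/= t0.
Qed.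

Lemma linear_span_gaussian_moments y : linear_span y -> gaussian_moments P y.
Proof.
have hG t : 0 <= t -> gaussian_moments P (G t).
  move=> t0; have Lt := linear_span_point t0.
  apply: gaussian_variable_moments; first exact: measurable_linear_span.
    exact: gaussian_linear_span.
  by apply: centeredG; rewrite /= in_itv/= t0.
move=> Ly; apply: gaussian_variable_moments; first exact: measurable_linear_span.
  exact: gaussian_linear_span.
move: Ly => [k [t [a [t0 ->]]]].
have ma (i : 'I_k) : all_moments (fun w => a i * G (t i) w).
  by apply: all_momentsZ; have [] := hG _ (t0 i).
have E0 : Ex (fun w => \sum_(i < k) a i * G (t i) w) = 0.
  rewrite Ex_sum => [|i _]; last exact: ma.
  rewrite big1// => i _; have [mi i0 _] := hG _ (t0 i).
  by rewrite ExZ// i0 mulr0.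
rewrite -ExE in E0; rewrite -[LHS]fineK ?E0// unlock.
apply: integrable_fin_num => //; apply: all_moments_integrable.
by apply: all_moments_sum => i _; exact: ma.
Qed.

Let LG := linear_span_gaussian_moments.

Lemma all_moments_increment s t : 0 <= s -> 0 <= t -> all_moments (increment s t).
Proof. by move=> s0 t0; have [] := LG (linear_span_increment s0 t0). Qed.

Lemma sq_dist_cov s t : sq_dist P G s t = cov (increment s t) (increment s t).
Proof. by rewrite /sq_dist ExE. Qed.

(** Polarisation: covariances of increments are second differences of [sq_dist]. *)
Lemma cov_increment a b c e : 0 <= a -> 0 <= b -> 0 <= c -> 0 <= e ->
  cov (increment a b) (increment c e) =
  (sq_dist P G a e + sq_dist P G b c - sq_dist P G b e - sq_dist P G a c) / 2.
Proof.
move=> a0 b0 c0 e0; rewrite !sq_dist_cov.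
have m s t s' t' : 0 <= s -> 0 <= t -> 0 <= s' -> 0 <= t' ->
    all_moments (fun w => increment s t w * increment s' t' w).
  by move=> *; apply: all_momentsM; exact: all_moments_increment.
rewrite -ExD; [|exact: m|exact: m].
have m1 : all_moments (fun w => increment a e w * increment a e w +
   increment b c w * increment b c w) by apply: all_momentsD; exact: m.
rewrite -ExB; [|exact: m1|exact: m].
rewrite -ExB; [|by apply: all_momentsB => //; exact: m|exact: m].
rewrite mulrC -ExZ; last by do 2 (apply: all_momentsB; last exact: m).
by congr Ex; apply/funext => w; rewrite /increment; field.
Qed.

(** Otherwise there are increments [X N] whose variance [v N] exceeds
    [(N+1)^2 |t - s|^(2 delta)].  By the Holder property, [X N ^+ 2 / v N] tends
    almost surely to [0]; but it has mean 1 and second moment 3, and truncating it at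
    6 keeps a mean of at least 1/2, which contradicts dominated convergence. *)
Lemma holder_variance delta K : 0 < K -> 0 < delta ->
  as_locally_holder P delta G ->
  exists2 C, 0 <= C & forall s t, 0 <= s <= K -> 0 <= t <= K ->
    sq_dist P G s t <= C * `|t - s| `^ (2 * delta).
Proof.
move=> K0 d0 hG; apply: contrapT => /forall2NP hC.
have /choice[st hst] : forall N : nat, exists p : R * R,
    [/\ 0 <= p.1 <= K, 0 <= p.2 <= K &
     N.+1%:R ^+ 2 * `|p.2 - p.1| `^ (2 * delta) < sq_dist P G p.1 p.2].
  move=> N; have [|/existsNP[s /existsNP[t]]] := hC (N.+1%:R ^+ 2).
    by rewrite exprn_ge0.
  move=> /not_implyP[hs /not_implyP[ht /negP]]; rewrite -ltNge => h.
  by exists (s, t).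
pose X N := increment (st N).1 (st N).2.
have LX N : linear_span (X N).
  have [/andP[? _] /andP[? _] _] := hst N; exact: linear_span_increment.
pose v N := sq_dist P G (st N).1 (st N).2.
have v0 N : 0 < v N.
  have [_ _] := hst N; apply: le_lt_trans.
  by rewrite mulr_ge0 ?exprn_ge0 ?powR_ge0.
pose Y N w := (v N)^-1 * X N w ^+ 2.
have Y0 N w : 0 <= Y N w by rewrite mulr_ge0 ?sqr_ge0// invr_ge0 ltW.
have mX N : all_moments (X N) by have [] := LG (LX N).
have mY N : all_moments (Y N) by apply: all_momentsZ; exact: all_momentsX.
have vE N : Ex (fun w => X N w ^+ 2) = v N by rewrite /v sq_dist_cov.
have EY N : Ex (Y N) = 1.
  by rewrite ExZ ?vE ?mulVf ?gt_eqF//; exact: all_momentsX.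
have EY2 N : Ex (fun w => Y N w ^+ 2) = 3.
  have -> : (fun w => Y N w ^+ 2) = fun w => (v N) ^- 2 * X N w ^+ 4.
    by apply/funext => w; rewrite /Y exprMn exprVn -exprM.
  rewrite ExZ; last exact: all_momentsX.
  have [_ _ ->] := LG (LX N); rewrite vE; field.
  by rewrite gt_eqF.
pose Z N w := Num.min (Y N w) 6.
have mZ N : measurable_fun [set: Omega] (Z N).
  by apply: measurable_minr; [have [] := mY N|exact: measurable_cst].
have Z0 N w : 0 <= Z N w by rewrite /Z le_min Y0 /=.
have Z6 N w : Z N w <= 6 by rewrite /Z ge_min lexx orbT.
have amZ N : all_moments (Z N).
  apply: (@all_moments_dominated _ _ _ P _ (fun p _ => 6 ^+ p)) => //.
  - by move=> p; exact: (finite_measure_integrable_cst P (6 ^+ p)).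
  - by move=> p w; rewrite ger0_norm// lerXn2r ?nnegrE.
have EZ N : 1 / 2 <= Ex (Z N).
  have : Ex (Y N) <= Ex (fun w => Z N w + 6^-1 * Y N w ^+ 2).
    apply: Ex_le => //.
      by apply: all_momentsD => //; apply: all_momentsZ; exact: all_momentsX.
    by move=> w; exact: le_min_sqr.
  have mY2 := all_momentsX 2 (mY N).
  rewrite ExD//; last exact: all_momentsZ.
  by rewrite EY (ExZ 6^-1 mY2) EY2; lra.
have aeZ : {ae P, forall w, [set: Omega] w -> (Z N w)%:E @[N --> \oo] --> 0%E}.
  apply: filterS hG => w /(_ K K0) /holder_on_ge0[C C0 hC'] _.
  apply: cvg_EFin; first by near=> N.
  apply/cvgr0Pnorm_le => e e0; near=> N => /=.
  rewrite ger0_norm//; apply: (@le_trans _ _ (Y N w)); first by rewrite /Z ge_min lexx.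
  have [h1 h2 h3] := hst N.
  have hX : X N w ^+ 2 <= C ^+ 2 * `|(st N).2 - (st N).1| `^ (2 * delta).
    rewrite -[leLHS]real_normK ?num_real//.
    have -> : C ^+ 2 * `|(st N).2 - (st N).1| `^ (2 * delta) =
        (C * `|(st N).2 - (st N).1| `^ delta) ^+ 2.
      by rewrite exprMn; congr (_ * _); rewrite mulrC powRrM powR_mulrn ?powR_ge0.
    rewrite lerXn2r ?nnegrE ?mulr_ge0 ?powR_ge0//.
    by apply: hC'; rewrite /= in_itv/=.
  rewrite /Y mulrC ler_pdivrMr//; apply: (le_trans hX).
  have NR : 0 < N.+1%:R ^+ 2 :> R by rewrite exprn_gt0.
  have hN : C ^+ 2 <= e * N.+1%:R ^+ 2.
    near: N; exists (Num.truncn (C ^+ 2 / e)) => // N /= hN.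
    rewrite mulrC -ler_pdivrMr//.
    have h : 0 <= C ^+ 2 / e by rewrite divr_ge0 ?sqr_ge0// ltW.
    have /andP[_ /ltW h'] := truncn_itv h; apply: le_trans h' _.
    rewrite -natrX ler_nat; apply: (@leq_trans N.+1); first by rewrite ltnS.
    by rewrite expnS leq_pmulr// expn_gt0.
  apply: (@le_trans _ _ (e * N.+1%:R ^+ 2 * `|(st N).2 - (st N).1| `^ (2 * delta))).
    by rewrite ler_wpM2r ?powR_ge0.
  by rewrite -mulrA ler_wpM2l ?(ltW e0)// ltW.
have mZE N : measurable_fun [set: Omega] (EFin \o Z N) by exact/measurable_EFinP.
have dom : {ae P, forall w, forall N : nat, [set: Omega] w ->
    (`|(Z N w)%:E| <= (cst 6%:E : Omega -> \bar R) w)%E}.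
  by apply: aeW => w N _; rewrite /= lee_fin ger0_norm.
have [_ _ lim] := @dominated_convergence _ _ _ P _ measurableT
  (fun N => EFin \o Z N) (cst 0%E) (cst 6%:E) mZE (measurable_cst _) aeZ
  (finite_measure_integrable_cst P 6 measurableT) dom.
rewrite integral0 in lim.
have h0 : (0 < 1 / 4 :> R) by [].
have /fine_cvgP[_ /cvgr0Pnorm_lt/(_ _ h0)] := lim.
case=> N _ /(_ N (leqnn N)) /=.
have := EZ N; rewrite /Ex /Rintegral; move: (fine _) => z hz.
rewrite ger0_norm; lra.
Unshelve. all: by end_near. Qed.

End gaussian_process_space.

(** * Decay of the covariance of increments *)

Section pseries.
Context {R : realType}.

(** The integral test in discrete form.  After division by [(r+1)^(1-p)] it follows
    from [exp y >= 1 + y] and [ln (1 - 1/(r+1)) <= - 1/(r+1)]. *)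
Lemma powR_telescope (p : R) (r : nat) : 1 < p -> (0 < r)%N ->
  r.+1%:R `^ (- p) <= (p - 1)^-1 * (r%:R `^ (1 - p) - r.+1%:R `^ (1 - p)).
Proof.
move=> p1 r0; have p10 : 0 < p - 1 by rewrite subr_gt0.
have rR : 0 < r%:R :> R by rewrite ltr0n.
have r1R : 0 < r.+1%:R :> R by rewrite ltr0n.
have neq : r.+1%:R != 0 :> R by rewrite gt_eqF.
rewrite ler_pdivlMl//.
pose x : R := - r.+1%:R^-1.
have xE : r%:R = r.+1%:R * (1 + x).
  by rewrite /x mulrDr mulr1 mulrN divff// -natr1 addrK.
have x1 : 0 < 1 + x by rewrite -(pmulr_rgt0 _ r1R) -xE.
have lnx : ln (1 + x) <= x.
  by rewrite -ler_expR lnK ?posrE// expR_ge1Dx.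
have -> : r.+1%:R `^ (- p) = r.+1%:R `^ (1 - p) * r.+1%:R^-1.
  rewrite -[X in _ * X]powR_inv1 ?ltW// -powRD ?neq ?implybT//.
  by congr powR; ring.
rewrite xE powRM ?(ltW r1R) ?(ltW x1)//.
set A := r.+1%:R `^ (1 - p); set B := (1 + x) `^ (1 - p).
rewrite (_ : (p - 1) * _ = A * ((p - 1) * r.+1%:R^-1)); last by ring.
rewrite (_ : A * B - A = A * (B - 1)); last by ring.
rewrite ler_wpM2l ?powR_ge0// lerBrDr /B /powR gt_eqF//.
apply: le_trans (expR_ge1Dx _); rewrite addrC lerD2l.
rewrite -(opprB p 1) mulNr -mulrN ler_wpM2l ?(ltW p10)//.
by rewrite lerNr.
Qed.

Lemma pseries_bounded (p : R) : 1 < p -> exists2 S : R, 0 <= S &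
  forall N : nat, \sum_(r < N) r.+1%:R `^ (- p) <= S.
Proof.
move=> p1; have p10 : 0 < p - 1 by rewrite subr_gt0.
exists (1 + (p - 1)^-1); first by rewrite addr_ge0// invr_ge0 ltW.
case=> [|N]; first by rewrite big_ord0 addr_ge0// invr_ge0 ltW.
suff : \sum_(r < N.+1) (r.+1%:R : R) `^ (- p) <=
    1 + (p - 1)^-1 * (1 - N.+1%:R `^ (1 - p)).
  move/le_trans; apply; rewrite lerD2l; apply: ler_piMr.
    by rewrite invr_ge0 ltW.
  by rewrite gerBl powR_ge0.
elim: N => [|N IH].
  by rewrite big_ord1 !powR1 subrr mulr0 addr0.
rewrite big_ord_recr /=; have := @powR_telescope p N.+1 p1 isT.
move: IH; set A := \sum_(_ < _) _; set B := _ `^ (- p).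
set C := N.+1%:R `^ _; set D := N.+2%:R `^ _ => h1 h2.
apply: le_trans (lerD h1 h2) _.
by rewrite -addrA -mulrDr addrA subrK.
Qed.

(** Each distance to [i] is attained at most twice, once on either side. *)
Lemma sum_dist_le (g : nat -> R) (N : nat) (i : 'I_N) : (forall r, 0 <= g r) ->
  \sum_(j < N) g `|(i : nat) - j|%N <= 2 * \sum_(r < N) g r.
Proof.
move=> g0; have hi := ltn_ord i.
rewrite -(big_mkord xpredT (fun j => g `|(i : nat) - j|%N)).
rewrite (@big_cat_nat _ _ _ i)//=; last exact: ltnW.
rewrite mulr_natl mulr2n -(big_mkord xpredT g); apply: lerD.
  rewrite big_nat_rev /= add0n (@big_cat_nat _ _ _ 1 0 N)//=; last by case: (N) i hi => // -[].
  apply: (@le_trans _ _ (\sum_(1 <= j < i.+1) g j)).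
    rewrite big_add1 /= le_eqVlt; apply/orP; left; apply/eqP.
    by apply: eq_big_nat => j /andP[_ ji]; congr g; lia.
  apply: (@le_trans _ _ (\sum_(1 <= j < N) g j)).
    by rewrite (@big_cat_nat _ _ _ i.+1 1 N)//= lerDl sumr_ge0.
  by rewrite lerDr sumr_ge0.
apply: (@le_trans _ _ (\sum_(0 <= j < N - i) g j)).
  rewrite -{1}[i : nat]add0n big_addn le_eqVlt; apply/orP; left; apply/eqP.
  by apply: eq_big_nat => j /andP[_ ji]; congr g; lia.
by rewrite (@big_cat_nat _ _ _ (N - i) 0 N)//= ?leq_subr// lerDl sumr_ge0.
Qed.

End pseries.

Section cov_increment_decay.
Context {R : realType} {d : measure_display} {Omega : measurableType d}.
Variable P : probability Omega R.
Variable G : R -> Omega -> R.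

(** The mean value theorem in each variable; [b < c] keeps the whole rectangle off the
    diagonal, and [0 < a] keeps it away from the axes. *)
Lemma rectangle_increment (D : R -> R -> R) a b c e : 0 < a -> a < b -> b < c ->
  c < e -> C11_on off_diagonal D ->
  exists x y, [/\ a <= x <= b, c <= y <= e &
   D b e - D a e - (D b c - D a c) = mixed_partial D x y * (b - a) * (e - c)].
Proof.
move=> a0 ab bc ce [hD _].
have off x y : x \in `[a, b] -> y \in `[c, e] -> off_diagonal (x, y).
  rewrite !in_itv/= => /andP[ax xb] /andP[cy ye]; split => /=; [lra|lra|].
  by rewrite lt_eqF//; lra.
have ce' : c \in `[c, e] by rewrite in_itv/= lexx ltW.
have ee' : e \in `[c, e] by rewrite in_itv/= lexx ltW.
have d1 x y : x \in `[a, b] -> y \in `[c, e] ->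
    is_derive x 1 (D ^~ y) (partial1 D x y).
  move=> hx hy; have [dd _ _] := hD _ _ (off _ _ hx hy).
  by apply: (DeriveDef dd); rewrite /partial1 derive1E.
have d2 x y : x \in `[a, b] -> y \in `[c, e] ->
    is_derive y 1 (partial1 D x) (mixed_partial D x y).
  move=> hx hy; have [_ _ dd] := hD _ _ (off _ _ hx hy).
  by apply: (DeriveDef dd); rewrite /mixed_partial /partial2 derive1E.
have d3 x : x \in `[a, b] ->
   is_derive x 1 (fun s => D s e - D s c) (partial1 D x e - partial1 D x c).
  by move=> hx; have h1 := d1 x e hx ee'; have h2 := d1 x c hx ce'; exact: is_deriveB.
have [x hx E1] := @MVT_segment _ (fun s => D s e - D s c)
    (fun x => partial1 D x e - partial1 D x c) a b (ltW ab)
    (fun x hx => d3 x (subset_itv_oo_cc hx))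
    (derivable_within_continuous (fun x hx => @ex_derive _ _ _ _ _ _ _ (d3 x hx))).
have [y hy E2] := @MVT_segment _ (partial1 D x) (mixed_partial D x) c e (ltW ce)
    (fun y hy => d2 x y hx (subset_itv_oo_cc hy))
    (derivable_within_continuous (fun y hy => @ex_derive _ _ _ _ _ _ _ (d2 x y hx hy))).
exists x, y; split; [by move: hx; rewrite in_itv|by move: hy; rewrite in_itv|].
by rewrite mulrAC -E2 -E1; ring.
Qed.

Hypothesis gaussG : gaussian_process P `[0, +oo[ G.
Hypothesis centeredG : centered P `[0, +oo[ G.

Lemma cov_increment_decay H : H < 1 -> assumption_A1 P H G ->
  exists2 C, 0 <= C & forall a b c e, 0 < a -> a < b -> b < c -> c < e ->
   `|cov P (increment G a b) (increment G c e)| <=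
     C * (b - a) * (e - c) * (c - b) `^ (2 * H - 2).
Proof.
move=> H1 [hD [C hC]]; exists (`|C| / 2); first by rewrite divr_ge0.
move=> a b c e a0 ab bc ce.
rewrite cov_increment//; try lra.
have [x [y [/andP[ax xb] /andP[cy ye] E]]] := rectangle_increment a0 ab bc ce hD.
set D := sq_dist P G in E *.
rewrite (_ : (_ + _ - _ - _) / 2 =
  - (D b e - D a e - (D b c - D a c)) / 2); last by ring.
have ba0 : 0 <= b - a by rewrite subr_ge0 ltW.
have ec0 : 0 <= e - c by rewrite subr_ge0 ltW.
rewrite E normrM normrN !normrM (ger0_norm ba0) (ger0_norm ec0).
rewrite (ger0_norm (_ : 0 <= 2^-1))//.
have xy : x < y := le_lt_trans xb (lt_le_trans bc cy).
have x0 : 0 < x := lt_le_trans a0 ax.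
have hxy : off_diagonal (x, y) by split; rewrite //= ?lt_eqF// (lt_trans x0).
have m1 : `|mixed_partial D x y| <= `|C| * (c - b) `^ (2 * H - 2).
  apply: le_trans (hC _ _ hxy) _.
  apply: (@le_trans _ _ (`|C| * `|y - x| `^ (2 * H - 2))).
    by rewrite ler_wpM2r ?powR_ge0// ler_norm.
  have yx0 : 0 < y - x by rewrite subr_gt0.
  have cb0 : 0 < c - b by rewrite subr_gt0.
  rewrite ler_wpM2l// (ger0_norm (ltW yx0)).
  have -> : 2 * H - 2 = - (2 - 2 * H) by ring.
  rewrite !powRN lef_pV2 ?posrE ?powR_gt0//.
  apply: ge0_ler_powR; rewrite ?nnegrE ?(ltW yx0) ?(ltW cb0)//.
    by rewrite subr_ge0 ler_piMr// ltW.
  exact: lerB.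
rewrite (_ : `|C| / 2 * _ * _ * _ =
  (`|C| * (c - b) `^ (2 * H - 2)) * (b - a) * (e - c) / 2); last by ring.
by rewrite !ler_wpM2r.
Qed.

End cov_increment_decay.

(** * Almost sure convergence of the quadratic variation *)

Section almost_sure_limit.
Context {R : realType} {d : measure_display} {Omega : measurableType d}.
Variable P : probability Omega R.
Local Notation rv := (Omega -> R).
Local Notation Ex := (Ex P).
Local Notation all_moments := (all_moments P).

(** The series of the [f n] has a finite expectation, so it converges almost surely
    and its terms tend to [0]. *)
Lemma ae_cvg0_of_summable_Ex (f : nat -> rv) (C p : R) : 1 < p -> 0 <= C ->
  (forall n w, 0 <= f n w) -> (forall n, all_moments (f n)) ->
  (forall n, Ex (f n) <= C * n.+1%:R `^ (- p)) ->
  {ae P, forall w, f n w @[n --> \oo] --> (0 : R)}.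
Proof.
move=> p1 C0 f0 mf hf.
have [S S0 hS] := @pseries_bounded R p p1.
have mE n : measurable_fun [set: Omega] (EFin \o f n).
  by apply/measurable_EFinP; have [] := mf n.
have fE0 n w : [set: Omega] w -> (0 <= (EFin \o f n) w)%E by rewrite lee_fin.
have IE n : (\int[P]_w (f n w)%:E = (Ex (f n))%:E)%E.
  rewrite /Ex /Rintegral fineK//; apply: integrable_fin_num => //.
  exact: all_moments_integrable.
have sumlt : (\int[P]_w (\sum_(0 <= n <oo) (f n w)%:E) < +oo)%E.
  rewrite (integral_nneseries P measurableT mE fE0).
  apply: (@le_lt_trans _ _ (C * S)%:E); last by rewrite ltry.
  apply: lime_le; first apply: is_cvg_nneseries => n _ _.
    by apply: integral_ge0 => w _; exact: fE0.
  near=> N; under eq_bigr do rewrite IE.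
  rewrite sumEFin lee_fin.
  apply: (@le_trans _ _ (\sum_(0 <= n < N) C * n.+1%:R `^ (- p))).
    by apply: ler_sum => n _; exact: hf.
  by rewrite -mulr_sumr ler_wpM2l// big_mkord.
have msum : measurable_fun [set: Omega] (fun w => \sum_(0 <= n <oo) (f n w)%:E)%E.
  exact: (@ge0_emeasurable_sum _ _ _ _ (fun n => EFin \o f n) xpredT
    (fun k x Dx _ => fE0 k x Dx) (fun k _ => mE k)).
have sum0 w : (0 <= \sum_(0 <= n <oo) (f n w)%:E)%E.
  by apply: nneseries_ge0 => n _ _; rewrite lee_fin.
have isum : P.-integrable [set: Omega] (fun w => \sum_(0 <= n <oo) (f n w)%:E)%E.
  apply/integrableP; split => //.
  by under eq_integral do rewrite gee0_abs//.
have := integrable_ae measurableT isum; apply: filterS => w /(_ I) hw.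
have tail : (\sum_(N <= k <oo) (f k w)%:E)%E @[N --> \oo] --> 0%E.
  apply: nneseries_tail_cvg => [|k _]; last by rewrite lee_fin.
  by rewrite ltey_eq hw.
have : (f n w)%:E @[n --> \oo] --> 0%E.
  apply: (squeeze_cvge _ (cvg_cst 0%E) tail); near=> N.
  rewrite lee_fin f0/=.
  have := @nneseries_lim_ge R (fun k => (f k w)%:E) xpredT N N.+1.
  by rewrite big_nat1; apply => k _ _; rewrite lee_fin.
by move=> /fine_cvgP[].
Unshelve. all: by end_near. Qed.

End almost_sure_limit.

Section blocks.
Context {R : realType} {d : measure_display} {Omega : measurableType d}.
Variable P : probability Omega R.
Variable G : R -> Omega -> R.

(** The blocks of [assumption_A3] are the index ranges between consecutive partial sums. *)
Lemma sum_block (F : nat -> R) (m k q : nat) : (0 < m)%N -> (0 < k)%N ->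
  \sum_(j \in @block R m k q.+1) F j =
  \sum_((Num.truncn (m%:R * (q%:R / k%:R) : R)).+1 <= j <
        (Num.truncn (m%:R * (q.+1%:R / k%:R) : R)).+1) F j.
Proof.
move=> m0 k0; have mR : 0 < m%:R :> R by rewrite ltr0n.
have kR : 0 < k%:R :> R by rewrite ltr0n.
rewrite [RHS]fsbig_seq ?iota_uniq//; apply: eq_fsbigl.
apply/seteqP; split=> j /=; rewrite mem_index_iota ltnS /=.
  move=> [h1 h2]; apply/andP; split.
    by rewrite truncn_lt_nat ?mulr_ge0 ?divr_ge0// mulrC -ltr_pdivlMr.
  by rewrite truncn_ge_nat ?mulr_ge0 ?divr_ge0// mulrC -ler_pdivrMr.
move=> /andP[h1 h2]; split.
  by rewrite ltr_pdivlMr// mulrC -truncn_lt_nat ?mulr_ge0 ?divr_ge0.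
by rewrite ler_pdivrMr// mulrC -truncn_ge_nat ?mulr_ge0 ?divr_ge0.
Qed.

(** The interval from [0] to [q/k] consists of [q] blocks. *)
Lemma A3_grid_sum H : assumption_A3 P H G -> forall k q, (0 < k)%N ->
  m%:R `^ (2 * H - 1) *
    grid_sum (fun i => sq_dist P G (i.-1%:R / m%:R) (i%:R / m%:R)) m (q%:R / k%:R)
  @[m --> \oo] --> (q%:R / k%:R : R).
Proof.
move=> hA3 k q k0; elim: q => [|q IH].
  rewrite mul0r; under eq_fun do rewrite /grid_sum mulr0 truncn0 big_geq// mulr0.
  exact: cvg_cst.
have E : q.+1%:R / k%:R = q%:R / k%:R + k%:R^-1 :> R.
  by rewrite -natr1 mulrDl mul1r.
rewrite [X in _ --> X]E.
apply: cvg_trans (cvgD IH (hA3 k q.+1 k0 isT)); apply: near_eq_cvg.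
near=> m; have m0 : (0 < m)%N by near: m; exists 1%N.
rewrite !fctE sum_block// (_ : -1 + 2 * H = 2 * H - 1); last by ring.
rewrite -mulrDr; congr (_ * _).
rewrite addrC -grid_sumB ?subrK// ler_pM2r ?invr_gt0 ?ltr0n// ler_nat//.
Unshelve. all: by end_near. Qed.

End blocks.

Section quadratic_variation.
Context {R : realType} {d : measure_display} {Omega : measurableType d}.
Variable P : probability Omega R.
Variable G : R -> Omega -> R.
Local Notation Ex := (Ex P).
Local Notation all_moments := (all_moments P).
Local Notation cov := (cov P).
Hypothesis gaussG : gaussian_process P `[0, +oo[ G.
Hypothesis centeredG : centered P `[0, +oo[ G.

Let LG := linear_span_gaussian_moments gaussG centeredG.

Definition grid_increment (m i : nat) : Omega -> R :=
  increment G (i%:R / m%:R) (i.+1%:R / m%:R).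

Lemma linear_span_grid m i : linear_span G (grid_increment m i).
Proof. by apply: linear_span_increment; rewrite divr_ge0. Qed.

Lemma sum_ord_eq0 N : \sum_(i < N) ((i : nat) == 0%N)%:R <= 1 :> R.
Proof.
case: N => [|N]; first by rewrite big_ord0.
by rewrite big_ord_recl /= big1 ?addr0.
Qed.

(** Every term is at most [A' = A^2 m^(-4 delta)] by the Cauchy-Schwarz inequality and
    the variance bound; this is used when the increments are equal or adjacent, and
    when one of them starts at time [0], where [assumption_A1] says nothing.  These are [O(N)]
    pairs.  The other terms decay with the distance of the indices, at a rate which is
    summable because [4 - 4 H > 1], and [m^(-4 H) <= m^(-4 delta)]. *)
Lemma grid_covariance_sum (H delta K : R) : 0 < K -> 0 < delta -> delta < H ->
  H < 3 / 4 -> assumption_A1 P H G -> as_locally_holder P delta G ->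
  exists2 C : R, 0 <= C & forall m N : nat, (0 < m)%N -> N%:R / m%:R <= K ->
   \sum_(i < N) \sum_(j < N) cov (grid_increment m i) (grid_increment m j) ^+ 2
     <= C * m%:R `^ (1 - 4 * delta).
Proof.
move=> K0 d0 dH H34 hA1 hA2.
have H1 : H < 1 by apply: lt_trans H34 _; lra.
have [A A0 hA] := holder_variance gaussG centeredG K0 d0 hA2.
have [B B0 hB] := cov_increment_decay gaussG centeredG H1 hA1.
have p1 : 1 < 4 - 4 * H by lra.
have [S S0 hS] := @pseries_bounded R _ p1.
exists (K * (6 * A ^+ 2 + 2 * B ^+ 2 * S)).
  by rewrite mulr_ge0 ?(ltW K0)// addr_ge0// !mulr_ge0// sqr_ge0.
move=> m N m0 NK; have mR : 0 < m%:R :> R by rewrite ltr0n.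
have mneq : m%:R != 0 :> R by rewrite gt_eqF.
have m1 : 1 <= m%:R :> R by rewrite ler1n.
pose A' := A ^+ 2 * m%:R `^ (- (4 * delta)).
pose B' := B ^+ 2 * m%:R `^ (- (4 * H)).
have A'0 : 0 <= A' by rewrite mulr_ge0 ?powR_ge0 ?sqr_ge0.
have B'0 : 0 <= B' by rewrite mulr_ge0 ?powR_ge0 ?sqr_ge0.
(* A bound depending on the distance r of the two indices; the gap between the
   two increments is r - 1 cells. *)
pose g r := if (r <= 1)%N then A' else B' * r.-1%:R `^ (- (4 - 4 * H)).
have g0 r : 0 <= g r by rewrite /g; case: ifP => // _; rewrite mulr_ge0// powR_ge0.
have iK i : (i <= N)%N -> 0 <= (i%:R / m%:R : R) <= K.
  move=> iN; rewrite divr_ge0//=; apply: le_trans NK.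
  by rewrite ler_pM2r ?invr_gt0// ler_nat.
have incE i : i.+1%:R / m%:R - i%:R / m%:R = m%:R^-1 :> R.
  by rewrite -mulrBl -natr1 addrAC subrr add0r mul1r.
have var i : (i < N)%N -> cov (grid_increment m i) (grid_increment m i) <=
    A * m%:R `^ (- (2 * delta)).
  move=> iN; rewrite /grid_increment -sq_dist_cov.
  apply: le_trans (hA _ _ (iK _ (ltnW iN)) (iK _ iN)) _.
  by rewrite incE ger0_norm ?invr_ge0// -(powR_inv1 (ltW mR)) -powRrM mulN1r.
have near_bound i j : (i < N)%N -> (j < N)%N ->
    cov (grid_increment m i) (grid_increment m j) ^+ 2 <= A'.
  move=> iN jN; have [mi _ _] := LG (linear_span_grid m i).
  have [mj _ _] := LG (linear_span_grid m j).
  apply: le_trans (cov_cauchy_schwarz mi mj) _.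
  have vi0 k : 0 <= cov (grid_increment m k) (grid_increment m k).
    by apply: Ex_ge0 => w; rewrite -expr2 sqr_ge0.
  apply: (@le_trans _ _ ((A * m%:R `^ (- (2 * delta))) * (A * m%:R `^ (- (2 * delta))))).
    by apply: ler_pM => //; exact: var.
  rewrite mulrACA -expr2 -powRD ?mneq ?implybT// /A'.
  rewrite (_ : - (2 * delta) + - (2 * delta) = - (4 * delta))//; ring.
have far_bound i j : (0 < i)%N -> (i.+1 < j)%N -> (j < N)%N ->
    cov (grid_increment m i) (grid_increment m j) ^+ 2 <= g (j - i)%N.
  move=> i0 ij jN.
  have ltd k l : (k < l)%N -> k%:R / m%:R < l%:R / m%:R :> R.
    by move=> kl; rewrite ltr_pM2r ?invr_gt0// ltr_nat.
  have := hB (i%:R / m%:R) (i.+1%:R / m%:R) (j%:R / m%:R) (j.+1%:R / m%:R).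
  rewrite divr_gt0 ?ltr0n// !ltd// !incE => /(_ isT isT isT isT).
  have -> : j%:R / m%:R - i.+1%:R / m%:R = (j - i).-1%:R * m%:R^-1 :> R.
    by rewrite -mulrBl -natrB ?subnS//; exact: ltnW.
  rewrite -[increment _ _ _]/(grid_increment m i) -[increment _ _ _]/(grid_increment m j).
  have -> : g (j - i)%N = B' * (j - i).-1%:R `^ (- (4 - 4 * H)).
    by rewrite /g ifF//; apply/negbTE; rewrite -ltnNge ltn_subRL addn1.
  move=> h; rewrite -[leLHS]real_normK ?num_real//.
  set r : R := (j - i).-1%:R in h *.
  have r0 : 0 <= r by [].
  apply: (@le_trans _ _ ((B * m%:R^-1 * m%:R^-1 * (r * m%:R^-1) `^ (2 * H - 2)) ^+ 2)).
    by rewrite lerXn2r ?nnegrE// !mulr_ge0 ?powR_ge0// invr_ge0 ltW.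
  rewrite powRM ?invr_ge0//; set u := m%:R^-1 `^ (2 * H - 2).
  have -> : (B * m%:R^-1 * m%:R^-1 * (r `^ (2 * H - 2) * u)) ^+ 2 =
      B ^+ 2 * (m%:R^-1 ^+ 4 * u ^+ 2) * (r `^ (2 * H - 2)) ^+ 2 by ring.
  have -> : (r `^ (2 * H - 2)) ^+ 2 = r `^ (- (4 - 4 * H)).
    by rewrite -powR_mulrn ?powR_ge0// -powRrM; congr powR; ring.
  suff -> : m%:R^-1 ^+ 4 * u ^+ 2 = m%:R `^ (- (4 * H)) by [].
  rewrite -(powR_mulrn 2) ?powR_ge0// -(powR_mulrn 4) ?invr_ge0//.
  rewrite /u -(powR_inv1 (ltW mR)) -!powRrM -!powRD ?mneq ?implybT//.
  by congr powR; ring.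
have bound (i j : 'I_N) : cov (grid_increment m i) (grid_increment m j) ^+ 2 <=
    ((i : nat) == 0%N)%:R * A' + ((j : nat) == 0%N)%:R * A' + g `|(i : nat) - j|%N.
  have nb := near_bound i j (ltn_ord i) (ltn_ord j).
  have [i0|i0] := posnP i.
    by rewrite mul1r -addrA (le_trans nb)// lerDl addr_ge0// mulr_ge0.
  have [j0|j0] := posnP j.
    by rewrite mul1r addrAC (le_trans nb)// lerDr addr_ge0// mulr_ge0.
  rewrite !mul0r !add0r.
  have [ij|ij] := leqP `|(i : nat) - j| 1; first by rewrite /g ij.
  have [le_ij|lt_ji] := leqP i j.
    rewrite distnEr//; apply: far_bound => //.
    by move: ij; rewrite distnEr// ltn_subRL addn1.
  rewrite distnEl ?(ltnW lt_ji)// covC; apply: far_bound => //.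
  by move: ij; rewrite distnEl ?(ltnW lt_ji)// ltn_subRL addn1.
have gsum : \sum_(r < N) g r <= 2 * A' + B' * S.
  apply: (@le_trans _ _ (\sum_(r < N.+2) g r)).
    by rewrite !big_ord_recr /= -addrA lerDl addr_ge0.
  have -> : \sum_(r < N.+2) g r =
      2 * A' + \sum_(r < N) B' * r.+1%:R `^ (- (4 - 4 * H)).
    by rewrite mulr_natl mulr2n -addrA !big_ord_recl; congr (_ + (_ + _)).
  by rewrite -mulr_sumr lerD2l ler_wpM2l.
have total : \sum_(i < N) \sum_(j < N)
    cov (grid_increment m i) (grid_increment m j) ^+ 2 <=
    N%:R * (6 * A' + 2 * B' * S).
  apply: (@le_trans _ _ (\sum_(i < N) \sum_(j < N)
    (((i : nat) == 0%N)%:R * A' + ((j : nat) == 0%N)%:R * A' + g `|(i : nat) - j|%N))).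
    by apply: ler_sum => i _; apply: ler_sum => j _; exact: bound.
  apply: (@le_trans _ _ (\sum_(i < N) (N%:R * (((i : nat) == 0%N)%:R * A') + A' +
    2 * (2 * A' + B' * S)))).
    apply: ler_sum => i _; rewrite !big_split /=; apply: lerD; first apply: lerD.
    - by rewrite sumr_const card_ord [leRHS]mulr_natl lexx.
    - by rewrite -mulr_suml -[leRHS]mul1r ler_wpM2r// sum_ord_eq0.
    - by apply: le_trans (sum_dist_le _ g0) _; rewrite ler_wpM2l.
  rewrite !big_split /= -mulr_sumr -mulr_suml !sumr_const card_ord.
  have h : N%:R * ((\sum_(i < N) ((i : nat) == 0%N)%:R) * A') <= N%:R * A'.
    by rewrite ler_wpM2l// -[leRHS]mul1r ler_wpM2r// sum_ord_eq0.
  rewrite -[A' *+ N]mulr_natl -[(2 * _) *+ N]mulr_natl.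
  apply: le_trans (lerD (lerD h (lexx _)) (lexx _)) _.
  by rewrite le_eqVlt; apply/orP; left; apply/eqP; ring.
apply: (le_trans total).
have B'le : B' <= B ^+ 2 * m%:R `^ (- (4 * delta)).
  by rewrite ler_wpM2l ?sqr_ge0// ler_powR// lerN2 ler_pM2l// ltW.
have NKm : N%:R <= K * m%:R by rewrite -ler_pdivrMr.
apply: (@le_trans _ _ ((K * m%:R) *
   ((6 * A ^+ 2 + 2 * B ^+ 2 * S) * m%:R `^ (- (4 * delta))))).
  apply: ler_pM => //; first by rewrite addr_ge0// !mulr_ge0.
  rewrite [leRHS](_ : _ = 6 * A' + 2 * (B ^+ 2 * m%:R `^ (- (4 * delta))) * S).
    by rewrite lerD2l ler_wpM2r// ler_wpM2l.
  by rewrite /A'; ring.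
rewrite (_ : _ * _ = K * (6 * A ^+ 2 + 2 * B ^+ 2 * S) *
   (m%:R * m%:R `^ (- (4 * delta)))); last by ring.
rewrite ler_wpM2l//.
  by rewrite mulr_ge0 ?(ltW K0)// addr_ge0// !mulr_ge0// sqr_ge0.
by rewrite -{1}[m%:R](powRr1 (ltW mR)) -powRD ?mneq ?implybT.
Qed.

End quadratic_variation.

Section almost_sure_quadratic_variation.
Context {R : realType} {d : measure_display} {Omega : measurableType d}.
Variable P : probability Omega R.
Variable G : R -> Omega -> R.
Hypothesis gaussG : gaussian_process P `[0, +oo[ G.
Hypothesis centeredG : centered P `[0, +oo[ G.

Let LD := @linear_span_comb R d Omega G.
Let LG := linear_span_gaussian_moments gaussG centeredG.

(** The expected weights are handled by [A3_grid_sum] and the fluctuation [Q] by its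
    fourth moment. *)
Lemma ae_grid_quadratic_variation (H : R) (k q : nat) : 0 < H < 3 / 4 ->
  assumption_A1 P H G -> assumption_A2 P H G -> assumption_A3 P H G ->
  (0 < k)%N ->
  {ae P, forall w, grid_sum (fun i => n%:R `^ (2 * H - 1) *
        (G (i%:R / n%:R) w - G (i.-1%:R / n%:R) w) ^+ 2) n (q%:R / k%:R)
       @[n --> \oo] --> (q%:R / k%:R : R)}.
Proof.
move=> /andP[H0 H34] hA1 hA2 hA3 k0.
pose y : R := q%:R / k%:R; have y0 : 0 <= y by rewrite divr_ge0.
(* Then 0 < delta < H and 8 (H - delta) <= 1/2, which leaves the exponent
   - 2 + 1/2 = - 3/2 for the fourth moments. *)
pose delta : R := H - Num.min (H / 2) (1 / 16).
have H20 : 0 < H / 2 by rewrite divr_gt0.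
have min0 : 0 < Num.min (H / 2) (1 / 16) by rewrite lt_min H20/=.
have delta0 : 0 < delta.
  rewrite subr_gt0 gt_min; apply/orP; left.
  by rewrite ltr_pdivrMr// mulr_natr mulr2n ltrDl.
have deltaH : delta < H by rewrite /delta gtrBl.
have delta16 : H - 1 / 16 <= delta by rewrite lerD2l lerN2 ge_min lexx orbT.
have K0 : 0 < y + 1 by rewrite ltr_wpDl.
have hAd : as_locally_holder P delta G by apply: hA2; rewrite delta0.
have [C C0 hC] := grid_covariance_sum gaussG centeredG K0 delta0 deltaH H34 hA1 hAd.
pose N m := Num.truncn (m%:R * y).
have NK m : (0 < m)%N -> (N m)%:R / m%:R <= y + 1.
  move=> m0; rewrite ler_pdivrMr ?ltr0n// mulrC.
  apply: (@le_trans _ _ (m%:R * y)); first by rewrite truncn_le mulr_ge0.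
  by rewrite ler_wpM2l// lerDl.
pose Q m w := m%:R `^ (2 * H - 1) *
  \sum_(i < N m) centered_sqr P (grid_increment G m i) w.
have mS m : all_moments P (fun w => \sum_(i < N m)
    centered_sqr P (grid_increment G m i) w).
  apply: all_moments_sum => i _; apply: (all_moments_centered_sqr LG).
  exact: linear_span_grid.
have mQ m : all_moments P (Q m) by exact: all_momentsZ.
pose f n w := Q n.+1 w ^+ 4.
have aef : {ae P, forall w, f n w @[n --> \oo] --> (0 : R)}.
  apply: (@ae_cvg0_of_summable_Ex _ _ _ P f (60 * C ^+ 2) (3 / 2)).
  - lra.
  - by rewrite mulr_ge0 ?sqr_ge0.
  - by move=> n w; rewrite /f (_ : 4%N = (2 * 2)%N)// exprM sqr_ge0.
  - by move=> n; exact: all_momentsX.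
  move=> n; set m := n.+1.
  have mR : 0 < m%:R :> R by [].
  have mneq : m%:R != 0 :> R by rewrite gt_eqF.
  have m1 : 1 <= m%:R :> R by rewrite ler1n.
  rewrite /f /Q -/m; under eq_fun do rewrite exprMn.
  rewrite ExZ; last exact: all_momentsX.
  have := chaos_fourth_moment LD LG (fun i : 'I_(N m) => linear_span_grid G m i).
  have := hC m (N m) isT (NK m isT).
  set S := \sum_i _ => hS h4.
  have S0 : 0 <= S by apply: sumr_ge0 => i _; apply: sumr_ge0 => j _; exact: sqr_ge0.
  have a0 : 0 <= m%:R `^ (2 * H - 1) ^+ 4 by rewrite exprn_ge0 ?powR_ge0.
  apply: le_trans (ler_wpM2l a0 h4) _.
  have hS2 : S ^+ 2 <= (C * m%:R `^ (1 - 4 * delta)) ^+ 2.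
    by rewrite lerXn2r ?nnegrE// mulr_ge0 ?powR_ge0.
  apply: (@le_trans _ _ (m%:R `^ (2 * H - 1) ^+ 4 *
     (60 * (C * m%:R `^ (1 - 4 * delta)) ^+ 2))).
    by rewrite ler_wpM2l// ler_wpM2l.
  rewrite (_ : _ * _ = 60 * C ^+ 2 * (m%:R `^ (2 * H - 1) ^+ 4 *
     m%:R `^ (1 - 4 * delta) ^+ 2)); last by ring.
  rewrite ler_wpM2l ?mulr_ge0 ?sqr_ge0//.
  rewrite -(powR_mulrn 2) ?powR_ge0// -(powR_mulrn 4) ?powR_ge0//.
  rewrite -!powRrM -powRD ?mneq ?implybT//.
  by apply: ler_powR => //; lra.
apply: filterS aef => w hf.
pose V n := grid_sum (fun i => n%:R `^ (2 * H - 1) *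
  (G (i%:R / n%:R) w - G (i.-1%:R / n%:R) w) ^+ 2) n (q%:R / k%:R).
suff limV : V n.+1 @[n --> \oo] --> (q%:R / k%:R : R).
  by rewrite -cvg_shiftS; exact: limV.
have Q0 : Q n.+1 w @[n --> \oo] --> (0 : R).
  apply/cvgr0Pnorm_le => e e0.
  have e40 : 0 < e ^+ 4 by rewrite exprn_gt0.
  have /cvgr0Pnorm_le/(_ _ e40) := hf; apply: filterS => n.
  by rewrite /f normrX ler_pXn2r ?nnegrE ?(ltW e0).
pose D n := n%:R `^ (2 * H - 1) * grid_sum
  (fun i => sq_dist P G (i.-1%:R / n%:R) (i%:R / n%:R)) n (q%:R / k%:R).
have limD : D n.+1 @[n --> \oo] --> (q%:R / k%:R : R).
  by have := @A3_grid_sum _ _ _ _ _ _ hA3 k q k0; rewrite -cvg_shiftS; apply.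
have lim : (Q n.+1 w + D n.+1) @[n --> \oo] --> (q%:R / k%:R : R).
  by have := cvgD Q0 limD; rewrite add0r; apply.
apply: cvg_trans lim; apply: near_eq_cvg.
near=> n; rewrite /Q /V /D.
set m := n.+1; rewrite -mulrDr /grid_sum -/y -/(N m) -mulr_sumr.
congr (_ * _); rewrite !big_add1 /= !big_mkord -big_split /=.
apply: eq_bigr => i _; rewrite sq_dist_cov /centered_sqr.
by rewrite -/(grid_increment G m i) subrK.
Unshelve. all: by end_near. Qed.

End almost_sure_quadratic_variation.

Lemma uniform_cvg_le {R : realType} (T : R) (F : nat -> R -> R) (f : R -> R) :
  (forall e, 0 < e -> \forall n \near \oo, forall t, 0 <= t <= T ->
     `|F n t - f t| <= e) ->
  {uniform `[0, T], F @ \oo --> f}.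
Proof.
move=> h A /uniform_nbhs[E [entE sub]].
move: entE; rewrite -entourage_ballE => -[e /= e0 he].
have e20 : 0 < e / 2 by rewrite divr_gt0.
apply: filterS (h _ e20) => n hn; apply: sub => t.
rewrite /= in_itv/= => ht; apply: he; rewrite /= /ball/= distrC.
apply: le_lt_trans (hn t ht) _.
by rewrite ltr_pdivrMr// ltr_pMr// ltr1n.
Qed.

(** * Quadratic variation of the Young integral *)

Unset Implicit Arguments.

Theorem theorem3p1 (R : realType) (d : measure_display)
    (Omega : measurableType d) (P : probability Omega R)
    (H beta T : R) (G u : R -> Omega -> R) :
  0 < H < 3 / 4 ->
  0 < T ->
  gaussian_process P `[0, +oo[ G ->
  centered P `[0, +oo[ G ->
  self_similar P H G ->
  assumption_A1 P H G ->
  assumption_A2 P H G ->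
  assumption_A3 P H G ->
  1 - H < beta ->
  is_process `[0, T] u ->
  as_holder_on P `[0, T] beta u ->
  {ae P, forall w,
    {uniform `[0, T],
      (fun (n : nat) (t : R) =>
         n%:R `^ (2 * H - 1) * quad_var n (integral_process u G ^~ w) t)
      @ \oo -->
      (fun t : R => \int[lebesgue_measure]_(s in `[0, t]) `|u s w| ^+ 2)}}.
Proof.
move=> /andP[H0 H34] T0 gaussG centeredG _ hA1 hA2 hA3 bH _ hu.
have H1 : H < 1 by apply: lt_trans H34 _; lra.
have b0 : 0 < beta by apply: lt_trans bH; rewrite subr_gt0.
(* Any exponent strictly between max 0 (1 - beta) and H would do. *)
pose delta := (H + Num.max 0 (1 - beta)) / 2.
have maxH : Num.max 0 (1 - beta) < H.
  by rewrite gt_max H0/= ltrBlDr -ltrBlDl.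
have dH : delta < H by rewrite ltr_pdivrMr// mulr_natr mulr2n ltrD2l.
have : Num.max 0 (1 - beta) < delta.
  by rewrite ltr_pdivlMr// mulr_natr mulr2n ltrD2r.
rewrite gt_max => /andP[d0 bd].
have bd1 : 1 < beta + delta by rewrite -ltrBlDl.
have hG : as_locally_holder P delta G by apply: hA2; rewrite d0.
have hV : {ae P, forall w, forall k q, (0 < k)%N ->
    grid_sum (fun i => n%:R `^ (2 * H - 1) *
        (G (i%:R / n%:R) w - G (i.-1%:R / n%:R) w) ^+ 2) n (q%:R / k%:R)
       @[n --> \oo] --> (q%:R / k%:R : R)}.
  apply: ae_foralln => k; apply: ae_foralln => q.
  case: (posnP k) => [->|k0]; first exact: aeW.
  have H034 : 0 < H < 3 / 4 by rewrite H0.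
  have := ae_grid_quadratic_variation gaussG centeredG q H034 hA1 hA2 hA3 k0.
  by apply: filterS => w hw _.
move: hu hG hV; apply: filterS3 => w huw hGw hVw.
apply: uniform_cvg_le.
exact: (quad_var_young_integral H1 T0 b0 d0 bd1 huw (hGw T T0) hVw).
Qed.
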